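(* Let $p \in (0,1)$. Define $\{X_i\}_{i\ge1}$ by: $X_1 = 1$ with probability one, and for each $n \ge 1$, with $U_n$ uniform on $\{1,\dots,n\}$ (independent of everything else), $X_{n+1} = X_{U_n}$ with probability $p$ and $X_{n+1}=0$ with probability $1-p$ (all choices independent). Let $H_n := \sum_{i=1}^n X_i$, $a_n := \frac{\Gamma(n+p)}{\Gamma(n)\Gamma(1+p)}$ for $n\ge1$, and let $\widehat{W} := \lim_{n\to\infty} H_n/a_n$ (which exists and is positive almost surely). Let $\mathcal{W} := \lim_{n\to\infty} H_n/n^p = \widehat W/\Gamma(1+p)$. Then, as $n\to\infty$, $$\frac{H_n - \widehat{W} a_n}{\sqrt{\widehat{W} a_n}} \xrightarrow{d} N(0,1),$$ and $$\frac{H_n - \widehat{W} a_n}{\sqrt{n^p}} \xrightarrow{d} \sqrt{\mathcal{W}'}\, Z,$$ where $Z$ has the standard normal distribution $N(0,1)$ and $\mathcal{W}'$ is independent of $Z$ and has the same distribution as $\mathcal{W}$.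
   Context: $\mathcal{W}$ has the Mittag--Leffler distribution with parameter $p$ (the distribution with $k$-th moments $k!/\Gamma(1+kp)$). *)

(* Defs.v *)
From HB Require Import structures.
From mathcomp Require Import all_boot all_order all_algebra.
From mathcomp Require Import all_classical all_reals all_analysis.
Set Implicit Arguments. Unset Strict Implicit. Unset Printing Implicit Defensive.
Import Order.TTheory GRing.Theory Num.Theory.
Import numFieldNormedType.Exports.
Local Open Scope classical_set_scope.
Local Open Scope ring_scope.

Definition Gamma {R : realType} (s : R) : R :=
  Rintegral lebesgue_measure `]0%R, +oo[%classic
    (fun x : R => x `^ (s - 1) * expR (- x)).

Definition a_seq {R : realType} (p : R) (n : nat) : R :=
  Gamma (n%:R + p) / (Gamma n%:R * Gamma (1 + p)).

Definition indep_UB {d} {T : measurableType d} {R : realType}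
  (P : probability T R) (U : nat -> T -> nat) (B : nat -> T -> bool) : Prop :=
  forall (I J : seq nat) (u : nat -> nat) (b : nat -> bool),
    uniq I -> uniq J -> all (fun n => 0 < n)%N I -> all (fun n => 0 < n)%N J ->
    P [set t | (forall n, n \in I -> U n t = u n) /\
               (forall n, n \in J -> B n t = b n)]
    = (\prod_(n <- I) P [set t | U n t = u n] *
       \prod_(n <- J) P [set t | B n t = b n])%E.

Definition indep2 {d} {T : measurableType d} {R : realType}
  (P : probability T R) (V W : T -> R) : Prop :=
  forall A B : set R, measurable A -> measurable B ->
    P (V @^-1` A `&` W @^-1` B) = (P (V @^-1` A) * P (W @^-1` B))%E.

Definition cvg_in_law {d d'} {T : measurableType d} {S : measurableType d'}
  {R : realType} (P : probability T R) (Y : nat -> T -> R)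
  (Q : probability S R) (V : S -> R) : Prop :=
  forall f : R -> R, continuous f -> (exists M : R, forall x, `|f x| <= M) ->
    (fun n => (\int[P]_t (f (Y n t))%:E)%E) @ \oo
      --> (\int[Q]_s (f (V s))%:E)%E.

(* Main.v *)
(* Fix n, let b = lambda a_n, and follow for k >= n the function
   F_k(H) = exp(- b^2 H / (2 a_k^2)) cos(c - b H / a_k) along the Markov chain H.
   One step changes its conditional mean only at third order in b / a_k and second
   order in H / k: the exponent b^2 H_k / a_k^2 is the conditional variance still to
   come, and it is a function of the present state. The errors are summed with an
   explicit supermartingale (urnB), so that, as k tends to infinity, the conditional
   characteristic function of lambda (H_n - What a_n) given H_n is found to be
   exp(- lambda^2 H_n / 2) up to an error that vanishes when lambda is
   theta / sqrt(H_n) or theta / sqrt(n^p). Levy's continuity theorem is obtained by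
   Gaussian smoothing. Positivity of What, needed for the first claim, follows from
   the same estimate: (H_n - What a_n) / sqrt(H_n) is tight, but equals sqrt(H_n),
   which tends to infinity, where What = 0. *)
Require Import Defs.
From HB Require Import structures.
From mathcomp Require Import all_boot all_order all_algebra.
From mathcomp Require Import all_classical all_reals all_analysis.
From mathcomp Require Import measurable_realfun simple_functions.
From mathcomp Require Import ring lra.
Set Implicit Arguments. Unset Strict Implicit. Unset Printing Implicit Defensive.
Import Order.TTheory GRing.Theory Num.Theory.
Import numFieldNormedType.Exports.
Local Open Scope classical_set_scope.
Local Open Scope ring_scope.

(** * Expectation of bounded measurable functions *)

(** The variance exponent is a telescoping sum. H_k / a_k is a martingale whose increment at step j
    has conditional variance about p H_j / (j a_j^2); the mean of H_j given H_k is H_k a_j / a_k,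
    and p / (j a_j) is about 1 / a_j - 1 / a_(j+1), so the total from k on is about H_k / a_k^2.
    Conditioning on H_n is expressed by transition operators in which H_n is frozen as a parameter;
    this is why the scale lambda may depend on H_n. It may not depend on What, which looks at the
    whole future: the first claim is therefore proved with sqrt(H_n) as the norm and then
    transferred to sqrt(What a_n), which requires What > 0. Cosines with an arbitrary phase stand in
    for complex exponentials. *)

Section bounded_expectation.
Context {d} {T : measurableType d} {R : realType}.
Implicit Types (P : probability T R) (f g : T -> R).

(** Boundedness gives integrability under every probability at once, so expectations stay real and
    one test function serves under several laws. *)
Definition bmeas f := measurable_fun setT f /\ exists M, forall t, `|f t| <= M.

Definition Ex P f : R := \int[P]_t f t.

Lemma bmeas_integrable P f : bmeas f -> P.-integrable setT (EFin \o f).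
Proof.
move=> [mf [M fM]]; apply: measurable_bounded_integrable => //.
  by rewrite [X in (X < _)%E]probability_setT ltry.
by exists M; split; rewrite ?num_real// => x Mx y _ /=; exact: le_trans (ltW Mx).
Qed.
Hint Resolve bmeas_integrable : core.

Lemma ExE P f : bmeas f -> (\int[P]_t (f t)%:E)%E = (Ex P f)%:E.
Proof.
move=> bf; rewrite /Ex /Rintegral fineK//.
exact: (integrable_fin_num _ (bmeas_integrable P bf)).
Qed.

Lemma bmeas_cst (c : R) : bmeas (fun _ => c).
Proof. by split=> //; exists `|c|. Qed.

Lemma bmeasN f : bmeas f -> bmeas (fun t => - f t).
Proof.
move=> [mf [M fM]]; split; first exact: measurableT_comp.
by exists M => t; rewrite normrN.
Qed.

Lemma bmeasD f g : bmeas f -> bmeas g -> bmeas (fun t => f t + g t).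
Proof.
move=> [mf [M fM]] [mg [N gN]]; split; first exact: measurable_funD.
by exists (M + N) => t; rewrite (le_trans (ler_normD _ _))// lerD.
Qed.

Lemma bmeasB f g : bmeas f -> bmeas g -> bmeas (fun t => f t - g t).
Proof. by move=> bf bg; apply: bmeasD => //; exact: bmeasN. Qed.

Lemma bmeasM f g : bmeas f -> bmeas g -> bmeas (fun t => f t * g t).
Proof.
move=> [mf [M fM]] [mg [N gN]]; split; first exact: measurable_funM.
by exists (M * N) => t; rewrite normrM ler_pM.
Qed.

Lemma bmeas_norm f : bmeas f -> bmeas (fun t => `|f t|).
Proof.
move=> [mf [M fM]]; split; first exact: measurableT_comp.
by exists M => t; rewrite normr_id.
Qed.

Lemma bmeas_sum (I : Type) (s : seq I) (F : I -> T -> R) :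
  (forall i, bmeas (F i)) -> bmeas (fun t => \sum_(i <- s) F i t).
Proof.
move=> bF; elim: s => [|i s IH].
  by under eq_fun do rewrite big_nil; exact: bmeas_cst.
by under eq_fun do rewrite big_cons; exact: bmeasD.
Qed.

Lemma bmeas_indic (A : set T) : measurable A -> bmeas (\1_A : T -> R).
Proof.
move=> mA; split; first exact: measurable_indic.
by exists 1 => t; rewrite indicE; case: (_ \in _); rewrite ?normr1 ?normr0.
Qed.

Lemma Ex_cst P (c : R) : Ex P (fun _ => c) = c.
Proof. by rewrite /Ex Rintegral_cst// [X in fine X]probability_setT mulr1. Qed.

Lemma ExD P f g : bmeas f -> bmeas g ->
  Ex P (fun t => f t + g t) = Ex P f + Ex P g.
Proof. by move=> bf bg; rewrite /Ex RintegralD//; exact: bmeas_integrable. Qed.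

Lemma ExB P f g : bmeas f -> bmeas g ->
  Ex P (fun t => f t - g t) = Ex P f - Ex P g.
Proof. by move=> bf bg; rewrite /Ex RintegralB//; exact: bmeas_integrable. Qed.

Lemma ExZ P (c : R) f : bmeas f -> Ex P (fun t => c * f t) = c * Ex P f.
Proof. by move=> bf; rewrite /Ex RintegralZl//; exact: bmeas_integrable. Qed.

Lemma Ex_sum P (I : Type) (s : seq I) (F : I -> T -> R) :
  (forall i, bmeas (F i)) ->
  Ex P (fun t => \sum_(i <- s) F i t) = \sum_(i <- s) Ex P (F i).
Proof.
move=> bF; elim: s => [|i s IH].
  by under [X in Ex P X]eq_fun do rewrite big_nil; rewrite Ex_cst big_nil.
under [X in Ex P X]eq_fun do rewrite big_cons.
by rewrite ExD// ?IH ?big_cons//; exact: bmeas_sum.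
Qed.

Lemma le_Ex P f g : bmeas f -> bmeas g -> (forall t, f t <= g t) ->
  Ex P f <= Ex P g.
Proof.
by move=> bf bg fg; rewrite /Ex le_Rintegral//; exact: bmeas_integrable.
Qed.

Lemma Ex_ge0 P f : (forall t, 0 <= f t) -> 0 <= Ex P f.
Proof. by move=> f0; exact: Rintegral_ge0. Qed.

Lemma Ex_norm P f : bmeas f -> `|Ex P f| <= Ex P (fun t => `|f t|).
Proof. by move=> bf; apply: le_normr_Rintegral => //; exact: bmeas_integrable. Qed.

Lemma Ex_indic P (A : set T) : measurable A -> Ex P \1_A = fine (P A).
Proof. by move=> mA; rewrite /Ex /Rintegral integral_indic// setIT. Qed.

Lemma Ex_ae P f g (N : set T) : bmeas f -> bmeas g -> measurable N ->
  P N = 0%E -> (forall t, ~ N t -> f t = g t) -> Ex P f = Ex P g.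
Proof.
move=> [mf _] [mg _] mN N0 fg; rewrite /Ex /Rintegral; congr fine.
apply: ae_eq_integral => //; [exact/measurable_EFinP|exact/measurable_EFinP|].
exists N; split=> // t /=; apply: contra_notP => Nt _.
by rewrite fg.
Qed.

Lemma Ex_cvg P (f_ : nat -> T -> R) f (M : R) (N : set T) :
  (forall n, measurable_fun setT (f_ n)) -> measurable_fun setT f ->
  (forall n t, `|f_ n t| <= M) -> measurable N -> P N = 0%E ->
  (forall t, ~ N t -> f_ n t @[n --> \oo] --> f t) ->
  Ex P (f_ n) @[n --> \oo] --> Ex P f.
Proof.
move=> mf_ mf fM mN N0 ff.
have ff' : {ae P, forall t, setT t ->
    (f_ n t)%:E @[n --> \oo] --> (f t)%:E}.
  exists N; split=> // t /=; apply: contra_notP => Nt _.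
  by apply: cvg_EFin; [exact: nearW|exact: ff].
have fM' : {ae P, forall t n, setT t -> (`|(f_ n t)%:E| <= M%:E)%E}.
  by apply: aeW => t n _; rewrite /= lee_fin.
have [fi _ h] := @dominated_convergence _ T R P setT measurableT
  (fun n t => (f_ n t)%:E) (fun t => (f t)%:E) (fun _ => M%:E)
  (fun n => (measurable_EFinP _ _).2 (mf_ n)) ((measurable_EFinP _ _).2 mf)
  ff' (bmeas_integrable P (bmeas_cst M)) fM'.
rewrite /Ex /Rintegral; apply: fine_cvg; rewrite fineK//.
exact: integrable_fin_num.
Qed.

End bounded_expectation.

(** * Integrals that ignore null sets, without measurability of the integrand *)

Section null_sets.
Import HBNNSimple.

(* No measurability is assumed of [f] : the lower integral of a nonnegative
   function ignores null sets by construction. *)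
Lemma le_ge0_integral_null {d} {T : measurableType d} {R : realType}
    (P : probability T R) (N : set T) (f g : T -> \bar R) :
  measurable N -> P N = 0%E -> (forall t, ~ N t -> f t = g t) ->
  (forall t, 0 <= f t)%E -> (forall t, 0 <= g t)%E ->
  (\int[P]_t f t <= \int[P]_t g t)%E.
Proof.
move=> mN N0 fg f0 g0; rewrite !ge0_integralTE//.
apply: ge_ereal_sup => _ [h /= hf <-].
apply: ereal_sup_ubound => /=.
have mC := measurableC mN.
(* Set to zero on [N], the simple function [h] lies below [g] everywhere and keeps its integral. *)
exists (proj_nnsfun h mC) => [t|].
  rewrite /=; rewrite mindicE; case: (boolP (t \in ~` N)) => tN.
    by rewrite mulr1 -fg ?hf//; move: tN; rewrite inE.
  by rewrite mulr0.
have e (k : {nnsfun T >-> R}) : sintegral P k = (\int[P]_t (k t)%:E)%E.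
  by rewrite integral_nnsfun// patch_setT.
rewrite !e; apply: ae_eq_integral => //; try exact/measurable_EFinP.
exists N; split=> // t /=; apply: contra_notP => Nt _.
by rewrite mindicE mem_set// mulr1.
Qed.

(** The theorem determines [X] from the draws only where these are in range. On the remaining null
    set [X] is arbitrary, so its integrands need not be measurable and [ae_eq_integral] does not
    apply to them. *)
Lemma integral_null_eq {d} {T : measurableType d} {R : realType}
    (P : probability T R) (N : set T) (f g : T -> \bar R) :
  measurable N -> P N = 0%E -> (forall t, ~ N t -> f t = g t) ->
  (\int[P]_t f t = \int[P]_t g t)%E.
Proof.
move=> mN N0 fg.
have ge0 (u v : T -> \bar R) : (forall t, ~ N t -> u t = v t) ->
    (forall t, 0 <= u t)%E -> (forall t, 0 <= v t)%E ->
    (\int[P]_t u t = \int[P]_t v t)%E.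
  move=> uv u0 v0; apply/eqP; rewrite eq_le; apply/andP; split.
    exact: (le_ge0_integral_null mN N0).
  by apply: (le_ge0_integral_null mN N0) => // t Nt; rewrite uv.
rewrite integralE [RHS]integralE; congr (_ - _)%E; apply: ge0 => t //.
  by move=> Nt; rewrite !funeposE fg.
by move=> Nt; rewrite !funenegE fg.
Qed.

End null_sets.

Section bounded_fubini.
Context {d d'} {T : measurableType d} {S : measurableType d'} {R : realType}.
Variables (P : probability T R) (Q : probability S R) (F : T * S -> R).
Hypothesis bF : bmeas F.

Lemma bmeas_section1 (s : S) : bmeas (fun t => F (t, s)).
Proof.
case: bF => mF [M FM]; split; last by exists M.
by apply: (measurableT_comp mF); exact: measurable_pair2.
Qed.

Lemma bmeas_section2 (t : T) : bmeas (fun s => F (t, s)).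
Proof.
case: bF => mF [M FM]; split; last by exists M.
by apply: (measurableT_comp mF); exact: measurable_pair1.
Qed.

Let iF : (P \x Q)%E.-integrable setT (EFin \o F) :=
  bmeas_integrable (P \x Q)%E bF.

Lemma bmeas_Ex2 : bmeas (fun t => Ex Q (fun s => F (t, s))).
Proof.
case: (bF) => mF [M FM]; split.
  apply/measurable_EFinP.
  rewrite (_ : _ \o _ = fun t => (\int[Q]_s (F (t, s))%:E)%E).
    exact: (measurable_fubini_F iF).
  by apply/funext => t /=; rewrite ExE//; exact: bmeas_section2.
exists M => t; apply: le_trans (Ex_norm _ (bmeas_section2 t)) _.
rewrite -[leRHS](Ex_cst Q M); apply: le_Ex => //; last exact: bmeas_cst.
exact/bmeas_norm/bmeas_section2.
Qed.

Lemma bmeas_Ex1 : bmeas (fun s => Ex P (fun t => F (t, s))).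
Proof.
case: (bF) => mF [M FM]; split.
  apply/measurable_EFinP.
  rewrite (_ : _ \o _ = fun s => (\int[P]_t (F (t, s))%:E)%E).
    exact: (measurable_fubini_G iF).
  by apply/funext => t /=; rewrite ExE//; exact: bmeas_section1.
exists M => t; apply: le_trans (Ex_norm _ (bmeas_section1 t)) _.
rewrite -[leRHS](Ex_cst P M); apply: le_Ex => //; last exact: bmeas_cst.
exact/bmeas_norm/bmeas_section1.
Qed.

Lemma Ex_fubini : Ex P (fun t => Ex Q (fun s => F (t, s))) =
                  Ex Q (fun s => Ex P (fun t => F (t, s))).
Proof.
have bF1 := bmeas_section1; have bF2 := bmeas_section2.
apply: EFin_inj; rewrite -[LHS](ExE P bmeas_Ex2) -[RHS](ExE Q bmeas_Ex1).
transitivity (\int[P]_t \int[Q]_s (F (t, s))%:E)%E.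
  by apply: eq_integral => t _; rewrite ExE.
rewrite (Fubini iF).
by apply: eq_integral => s _; rewrite ExE.
Qed.

End bounded_fubini.

(** * Equality in law *)

Section laws.
Context {R : realType}.

Lemma Ex_law {d d' dA} {T : measurableType d} {S : measurableType d'}
    {A : measurableType dA} (P : probability T R) (Q : probability S R)
    (X : T -> A) (Y : S -> A) (f : A -> R) :
  measurable_fun setT X -> measurable_fun setT Y ->
  (forall B, measurable B -> P (X @^-1` B) = Q (Y @^-1` B)) -> bmeas f ->
  Ex P (fun t => f (X t)) = Ex Q (fun s => f (Y s)).
Proof.
move=> mX mY XY [mf [M fM]].
pose X' : {RV P >-> A} := mfun_Sub (mem_set mX).
pose Y' : {RV Q >-> A} := mfun_Sub (mem_set mY).
have mf' : measurable_fun setT (EFin \o f) by exact/measurable_EFinP.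
have h1 := @integral_distribution _ _ _ _ _ P X' (EFin \o f) mf'.
have h2 := @integral_distribution _ _ _ _ _ Q Y' (EFin \o f) mf'.
have b1 : bmeas (fun t => f (X t)) by split; [exact: measurableT_comp|exists M].
have b2 : bmeas (fun t => f (Y t)) by split; [exact: measurableT_comp|exists M].
rewrite /Ex /Rintegral; congr fine.
have {}h1 := h1 (bmeas_integrable P b1).
have {}h2 := h2 (bmeas_integrable Q b2).
rewrite [LHS](_ : _ = (\int[P]_x ((EFin \o f) \o X') x)%E)// -h1.
rewrite [RHS](_ : _ = (\int[Q]_x ((EFin \o f) \o Y') x)%E)// -h2.
by apply: eq_measure_integral => B mB _; exact: XY.
Qed.

(** Factorization on rectangles identifies the joint law as a product measure; the first marginal is
    then carried over to [P]. A mixture built on [Q] thus becomes an average over the original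
    space. *)
Lemma Ex_indep_law {d d' dA dB} {T : measurableType d} {S : measurableType d'}
    {A : measurableType dA} {B : measurableType dB}
    (P : probability T R) (Q : probability S R) (G : probability B R)
    (V : S -> A) (W : S -> B) (X : T -> A) (F : A * B -> R) :
  measurable_fun setT V -> measurable_fun setT W -> measurable_fun setT X ->
  (forall C D, measurable C -> measurable D ->
    Q (V @^-1` C `&` W @^-1` D) = (Q (V @^-1` C) * Q (W @^-1` D))%E) ->
  (forall C, measurable C -> Q (V @^-1` C) = P (X @^-1` C)) ->
  (forall D, measurable D -> Q (W @^-1` D) = G D) -> bmeas F ->
  Ex Q (fun s => F (V s, W s)) = Ex P (fun t => Ex G (fun z => F (X t, z))).
Proof.
move=> mV mW mX VW VX WG bF.
have mVW : measurable_fun setT (fun s => (V s, W s)) by exact: measurable_fun_pair.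
pose VW' : {RV Q >-> (A * B)%type} := mfun_Sub (mem_set mVW).
pose V' : {RV Q >-> A} := mfun_Sub (mem_set mV).
have law := @product_measure_unique _ _ _ _ R (distribution Q V') G
  (distribution Q VW').
have -> : Ex Q (fun s => F (V s, W s)) = Ex (distribution Q V' \x G)%E F.
  apply: (@Ex_law _ _ _ _ _ _ Q (distribution Q V' \x G)%E _ id) => //.
  move=> E mE; rewrite preimage_id; apply/esym/law => // C D mC mD.
  transitivity (Q (V @^-1` C) * Q (W @^-1` D))%E; first exact: VW.
  by rewrite WG.
have bF2 := bmeas_Ex2 (distribution Q V') G bF.
transitivity (Ex (distribution Q V') (fun w => Ex G (fun z => F (w, z)))).
  apply: EFin_inj; rewrite -!ExE//.
  rewrite -(integral12_prod_meas1 (bmeas_integrable (distribution Q V' \x G)%E bF)).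
  by apply: eq_integral => w _; rewrite -ExE//; exact: bmeas_section2.
exact: (@Ex_law _ _ _ _ _ _ (distribution Q V') P id X
  (fun w => Ex G (fun z => F (w, z)))).
Qed.

End laws.

(** * Characteristic function of the normal distribution *)

Section normal_characteristic_function.
Context {R : realType}.
Notation mu := (@lebesgue_measure R).

Lemma integral_normal_prob (m s : R) (f : R -> R) : bmeas f ->
  (\int[normal_prob m s]_x (f x)%:E)%E =
  (\int[mu]_x ((f x * normal_pdf m s x)%:E))%E.
Proof.
move=> bf; have dom := @normal_prob_dominates R m s.
rewrite -(Radon_Nikodym_change_of_variables dom)//=; last first.
  exact: (bmeas_integrable (normal_prob m s)).
have mf : measurable_fun setT (EFin \o f) by apply/measurable_EFinP; case: bf.
under [RHS]eq_integral do rewrite EFinM.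
apply: ae_eq_integral => //.
- exact: emeasurable_funM.
- apply: emeasurable_funM => //=; apply/measurableT_comp => //=.
  exact: measurable_normal_pdf.
- apply: ae_eqe_mul2l => /=.
  rewrite Radon_NikodymE//=; case: cid => /= h [h1 h2 h3].
  apply: integral_ae_eq => //=.
  + by apply/measurableT_comp =>//; exact: measurable_normal_pdf.
  + by move=> E E01 mE; rewrite -h3.
Qed.

Lemma Ex_normal_prob (m s : R) (f : R -> R) : bmeas f ->
  Ex (normal_prob m s) f = \int[mu]_x (f x * normal_pdf m s x).
Proof. by move=> bf; rewrite /Ex /Rintegral integral_normal_prob. Qed.

Let gs (x : R) := expR (- (x ^+ 2 / 2)).

Lemma normal_pdf01E x : normal_pdf 0 1 x = normal_peak 1 * gs x :> R.
Proof.
rewrite normal_pdfE ?oner_neq0// /normal_fun subr0 expr1n /gs.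
by rewrite mulNr.
Qed.

Let is_derive_gs (x : R) : is_derive x 1 gs (- x * gs x).
Proof.
rewrite /gs; apply: is_derive_eq.
by rewrite /GRing.scale/=; lra.
Qed.

Notation n01 := (normal_pdf (0 : R) 1).

Let n01E : n01 = fun x => normal_peak 1 * gs x.
Proof. by apply/funext => x; exact: normal_pdf01E. Qed.

Let is_derive_n01 (x : R) : is_derive x 1 n01 (- x * n01 x).
Proof.
rewrite n01E; have dg := is_derive_gs x; apply: is_derive_eq.
by rewrite /GRing.scale/=; lra.
Qed.

Let measurable_n01 : measurable_fun setT n01.
Proof. exact: measurable_normal_pdf. Qed.

(** A density of twice the deviation absorbs the linear factor: the exponents differ by 3/8 x^2,
    where 3/8 = 1/2 - 1/8, and [|x|] is at most 3 (1 + 3/8 x^2). The majorant is a multiple of a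
    density, hence integrable. *)
Let norm_mul_n01_le (x : R) :
  `|x| * n01 x <= 3 * normal_peak 1 / normal_peak 2 * normal_pdf 0 2 x.
Proof.
have p2 : 0 < normal_peak (2 : R) by apply: normal_peak_gt0; rewrite pnatr_eq0.
rewrite normal_pdf01E normal_pdfE ?pnatr_eq0// mulrA mulfVK ?gt_eqF//.
rewrite mulrCA [3 * _]mulrC -mulrA ler_wpM2l ?normal_peak_ge0//.
rewrite /normal_fun subr0 /gs.
have -> : - (x ^+ 2 / 2) = - x ^+ 2 / (2 ^+ 2 *+ 2) + - (3 / 8 * x ^+ 2).
  by rewrite -mulr_natr; field.
rewrite expRD mulrCA [X in _ <= X]mulrC ler_wpM2l ?expR_ge0//.
rewrite expRN ler_pdivrMr ?expR_gt0//.
have h := expR_ge1Dx (3 / 8 * x ^+ 2).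
apply: (@le_trans _ _ (3 * (1 + 3 / 8 * x ^+ 2))); last by rewrite ler_pM2l.
have -> : x ^+ 2 = `|x| ^+ 2 by rewrite -normrX ger0_norm ?sqr_ge0.
nra.
Qed.

Let integrable_bounded_n01 (f : R -> R) (c : R) : measurable_fun setT f ->
  (forall x, `|f x| <= c * (1 + `|x|)) ->
  mu.-integrable setT (fun x => (f x * n01 x)%:E).
Proof.
move=> mf fc.
have i1 : mu.-integrable setT (fun x => (n01 x)%:E).
  exact: integrable_normal_pdf.
have i2 : mu.-integrable setT (fun x => (normal_pdf 0 2 x)%:E).
  exact: integrable_normal_pdf.
have i3 := integrableD measurableT (integrableZl measurableT c i1)
  (integrableZl measurableT (c * (3 * normal_peak 1 / normal_peak 2)) i2).
apply: (le_integrable _ _ _ i3) => //.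
  by apply/measurable_EFinP; exact: measurable_funM.
move=> x _; rewrite /= lee_fin.
have n0 := normal_pdf_ge0 0 1 x; have := normal_pdf_ge0 0 2 x => n2.
have c0 : 0 <= c by have := le_trans (normr_ge0 _) (fc 0); rewrite normr0; lra.
rewrite normrM (ger0_norm n0).
apply: le_trans (ler_norm _).
apply: (@le_trans _ _ (c * (1 + `|x|) * n01 x)); first by rewrite ler_wpM2r.
have := ler_wpM2l c0 (norm_mul_n01_le x).
by rewrite mulrDr mulr1 mulrDl lerD2l !mulrA.
Qed.

Let n01_decay (x : R) : `|x| * n01 x <= 3 * normal_peak 1.
Proof.
have p2 : 0 < normal_peak (2 : R) by apply: normal_peak_gt0; rewrite pnatr_eq0.
apply: le_trans (norm_mul_n01_le x) _.
rewrite -[X in _ <= X](mulfVK (lt0r_neq0 p2)).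
apply: ler_wpM2l.
  by rewrite divr_ge0 ?mulr_ge0 ?normal_peak_ge0.
by apply: normal_pdf_ub; rewrite pnatr_eq0.
Qed.

Variable alpha : R.

Let g (t x : R) := (t * cos (t * x + alpha) - x * sin (t * x + alpha)) * n01 x.
Let G (t x : R) := sin (t * x + alpha) * n01 x.

Let is_derive_G (t x : R) : is_derive x 1 (G t) (g t x).
Proof.
have da : is_derive x 1 (fun x : R => t * x + alpha) t.
  by apply: is_derive_eq; rewrite /GRing.scale/=; ring.
have ds : is_derive x 1 (fun x => sin (t * x + alpha)) (cos (t * x + alpha) * t).
  exact: (@is_derive1_comp R sin (fun x : R => t * x + alpha) x).
have dn := is_derive_n01 x.
rewrite /G /g; apply: is_derive_eq.
by rewrite /GRing.scale/=; ring.
Qed.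

Let norm_cos_le1 (x : R) : `|cos x| <= 1.
Proof. by rewrite ler_norml cos_geN1 cos_le1. Qed.

Let norm_sin_le1 (x : R) : `|sin x| <= 1.
Proof. by rewrite ler_norml sin_geN1 sin_le1. Qed.

Let measurable_affine (t : R) : measurable_fun setT (fun x => t * x + alpha).
Proof. by apply: measurable_funD => //; exact: measurable_funM. Qed.

Let measurable_cos : measurable_fun setT (@cos R).
Proof. by apply: continuous_measurable_fun; exact: continuous_cos. Qed.

Let measurable_sin : measurable_fun setT (@sin R).
Proof. by apply: continuous_measurable_fun; exact: continuous_sin. Qed.

Let integrable_cos (t : R) :
  mu.-integrable setT (fun x => (cos (t * x + alpha) * n01 x)%:E).
Proof.
apply: (@integrable_bounded_n01 (fun x => cos (t * x + alpha)) 1).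
  exact: measurableT_comp.
by move=> x; apply: le_trans (norm_cos_le1 _) _; rewrite mul1r lerDl.
Qed.

Let integrable_sin (t : R) :
  mu.-integrable setT (fun x => (x * sin (t * x + alpha) * n01 x)%:E).
Proof.
apply: (@integrable_bounded_n01 (fun x => x * sin (t * x + alpha)) 1).
  by apply: measurable_funM => //; exact: measurableT_comp.
move=> x; rewrite normrM mul1r; apply: (@le_trans _ _ (`|x| * 1)).
  exact: ler_wpM2l.
by rewrite mulr1 lerDr.
Qed.

Let integrable_g (t : R) : mu.-integrable setT (fun x => (g t x)%:E).
Proof.
rewrite (_ : (fun _ => _) = (fun x => t%:E * (cos (t * x + alpha) * n01 x)%:E -
    (x * sin (t * x + alpha) * n01 x)%:E)%E).
  by apply: integrableB => //; exact: integrableZl.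
by apply/funext => x; rewrite -EFinM -EFinB mulrA /g -mulrBl.
Qed.

(** Stein's identity for the normal law: [g t] is the derivative of [G t], and the boundary terms at
    n + 1 and - (n + 1) vanish by [n01_decay]. *)
Let integral_g (t : R) : \int[mu]_x g t x = 0.
Proof.
pose I (n : nat) : set R := `[- n.+1%:R, n.+1%:R]%classic.
have cG : continuous (G t).
  by move=> x; apply/differentiable_continuous/derivable1_diffP; have [] := is_derive_G t x.
have ftc n : (\int[mu]_(x in I n) (g t x)%:E =
              (G t n.+1%:R)%:E - (G t (- n.+1%:R))%:E)%E.
  apply: continuous_FTC2.
  - by rewrite (@lt_trans _ _ 0) ?oppr_lt0 ?ltr0n.
  - apply: continuous_subspaceT => x.
    apply: cvgM; last by apply: continuous_normal_pdf; rewrite oner_neq0.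
    have ca : (t * x + alpha) @[x --> x] --> t * x + alpha.
      by apply: cvgD; [apply: cvgM; [exact: cvg_cst|exact: cvg_id]|exact: cvg_cst].
    apply: cvgB; apply: cvgM; [exact: cvg_cst| |exact: cvg_id|].
      by apply: (cvg_comp _ _ ca); exact: continuous_cos.
    by apply: (cvg_comp _ _ ca); exact: continuous_sin.
  - by split=> [x _||]; [exact: ex_derive|apply: cvg_at_right_filter; exact: cG
                        |apply: cvg_at_left_filter; exact: cG].
  - by move=> x _; rewrite derive1E; exact: derive_val.
have dct : (\int[mu]_(x in I n) (g t x)%:E)%E @[n --> \oo]
    --> (\int[mu]_x (g t x)%:E)%E.
  under eq_fun do rewrite integral_mkcond.
  have mg : measurable_fun setT (fun x => (g t x)%:E).
    exact: (measurable_int mu).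
  have mg_ n : measurable_fun setT ((fun x => (g t x)%:E) \_ (I n)).
    by apply/(measurable_restrictT _ _).1; [exact: measurable_itv|exact: measurable_funTS].
  have cg : {ae mu, forall x, setT x ->
      ((fun x => (g t x)%:E) \_ (I n)) x @[n --> \oo] --> (g t x)%:E}.
    apply: aeW => x _; apply: cvg_near_cst.
    near=> n; rewrite patchE mem_set// /I/= in_itv/= -ler_norml.
    apply: (@le_trans _ _ n%:R); last by rewrite ler_nat.
    by near: n; exact: nbhs_infty_ger.
  have dg : {ae mu, forall x n, setT x ->
      (`|((fun x => (g t x)%:E) \_ (I n)) x| <= `|(g t x)%:E|)%E}.
    apply: aeW => x n _; rewrite patchE; case: ifP => _ //.
    by rewrite abse0 abse_ge0.
  by have [] := @dominated_convergence _ _ R mu setT measurableT _ _ _ mg_ mg cg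
    (integrable_abse (integrable_g t)) dg.
have lim0 : ((G t n.+1%:R)%:E - (G t (- n.+1%:R))%:E)%E @[n --> \oo]
    --> (0 : \bar R).
  under eq_fun do rewrite -EFinB.
  apply: cvg_EFin; first exact: nearW.
  apply/cvgr0Pnorm_le => e e0.
  near=> n.
  have b (x : R) : `|x| = n.+1%:R -> `|G t x| <= 3 * normal_peak 1 / n.+1%:R.
    move=> xn; rewrite ler_pdivlMr ?ltr0n// -xn mulrC.
    apply: le_trans (n01_decay x); rewrite ler_wpM2l// /G normrM.
    by rewrite (ger0_norm (normal_pdf_ge0 _ _ _)) ler_piMl// normal_pdf_ge0.
  rewrite /= (le_trans (ler_normB _ _))//.
  apply: (@le_trans _ _ (6 * normal_peak 1 / n.+1%:R)).
    rewrite [leRHS](_ : _ = 3 * normal_peak 1 / n.+1%:R +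
      3 * normal_peak 1 / n.+1%:R); last by rewrite -!mulrDl; congr (_ * _ / _); ring.
    by apply: lerD; apply: b; rewrite ?normrN normr_nat.
  rewrite ler_pdivrMr ?ltr0n// -ler_pdivrMl//.
  apply: (@le_trans _ _ n%:R); last by rewrite ler_nat.
  by near: n; exact: nbhs_infty_ger.
move: dct; rewrite (funext ftc) => dct.
rewrite /Rintegral -(cvg_lim (@ereal_hausdorff R) dct).
by rewrite (cvg_lim (@ereal_hausdorff R) lim0).
Unshelve. all: by end_near. Qed.

Let phi (t : R) := \int[mu]_x (cos (t * x + alpha) * n01 x).

(** Differentiating under the integral, with majorant [|x| * n01 x], yields minus the mean of x
    sin(t x + alpha); Stein's identity turns that mean into t times [phi t]. *)
Let is_derive_phi (t : R) : is_derive t 1 phi (- t * phi t).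
Proof.
pose f (t x : R) := cos (t * x + alpha) * n01 x.
have df (u x : R) : is_derive u 1 (f ^~ x) (- (x * sin (u * x + alpha) * n01 x)).
  have da : is_derive u 1 (fun u : R => u * x + alpha) x.
    by apply: is_derive_eq; rewrite /GRing.scale/=; ring.
  have dc : is_derive u 1 (fun u => cos (u * x + alpha)) (- sin (u * x + alpha) * x).
    exact: (@is_derive1_comp R cos (fun u : R => u * x + alpha) u).
  by rewrite /f; apply: is_derive_eq; rewrite /GRing.scale/=; ring.
have It : `]t - 1, t + 1[%classic t by rewrite /= in_itv/=; lra.
have intf u : `]t - 1, t + 1[%classic u -> mu.-integrable setT (EFin \o f u).
  by move=> _; exact: integrable_cos.
have df1 u x : `]t - 1, t + 1[%classic u -> setT x -> derivable (f ^~ x) u 1.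
  by move=> _ _; have [] := df u x.
pose G0 (x : R) := `|x| * n01 x.
have G0_ge0 x : 0 <= G0 x by rewrite mulr_ge0// normal_pdf_ge0.
have iG0 : mu.-integrable setT (EFin \o G0).
  apply: (@integrable_bounded_n01 (fun x => `|x|) 1) => // x.
  by rewrite normr_id mul1r lerDr.
have dG u x : `]t - 1, t + 1[%classic u -> setT x ->
    `|partial1of2 f u x| <= G0 x.
  move=> _ _; rewrite partial1of2E; have [_ ->] := df u x.
  rewrite normrN normrM (ger0_norm (normal_pdf_ge0 _ _ _)) ler_wpM2r ?normal_pdf_ge0//.
  by rewrite normrM ler_piMr.
have d1 := derivable_under_integral measurableT It intf df1 G0_ge0 iG0 dG.
have := differentiation_under_integral measurableT It intf df1 G0_ge0 iG0 dG.
rewrite derive1E => d2.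
apply: DeriveDef => //.
rewrite [LHS]d2.
under eq_Rintegral do rewrite partial1of2E (@derive_val _ _ _ _ _ _ _ (df t _)).
have := integral_g t; rewrite /g.
under eq_Rintegral do rewrite mulrBl -mulrA.
rewrite RintegralB//; [|exact: (integrableZl measurableT t (integrable_cos t))
                       |exact: integrable_sin].
rewrite RintegralZl//; last exact: integrable_cos.
rewrite -/(phi t) => /eqP; rewrite subr_eq0 => /eqP e.
rewrite mulNr e.
under eq_Rintegral do rewrite -mulN1r.
rewrite RintegralZl//; last exact: integrable_sin.
by rewrite mulN1r.
Qed.

(** The phase makes this the whole characteristic function: alpha = 0 gives the real part, alpha = -
    pi / 2 the imaginary part. The equation phi' = - t phi makes phi(t) exp(t^2 / 2) constant. *)
Lemma Ex_cos_normal (t : R) :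
  Ex (normal_prob 0 1) (fun x => cos (t * x + alpha)) =
  expR (- (t ^+ 2 / 2)) * cos alpha.
Proof.
have bcos : bmeas (fun x => cos (t * x + alpha)).
  by split; [exact: measurableT_comp|exists 1].
rewrite Ex_normal_prob// -/(phi t).
have d0 (u : R) : is_derive u 1 (fun u => phi u * expR (u ^+ 2 / 2)) 0.
  have dp := is_derive_phi u.
  by apply: is_derive_eq; rewrite /GRing.scale/=; lra.
have := @is_derive_0_is_cst _ (fun u => phi u * expR (u ^+ 2 / 2)) t 0 d0.
rewrite expr0n mul0r expR0 mulr1 => e.
have p0 : phi 0 = cos alpha.
  rewrite /phi; under eq_Rintegral do rewrite mul0r add0r.
  rewrite RintegralZl//; last exact: integrable_normal_pdf.
  by rewrite /Rintegral integral_normal_pdf /= mulr1.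
by rewrite expRN mulrC -p0 -e mulfK// gt_eqF// expR_gt0.
Qed.

End normal_characteristic_function.

(** * Levy's continuity theorem *)

(** Only [x] is confined to the segment; [c] may leave it, as the Gaussian smoothing around [x]
    requires. Hence a covering argument by balls of half the local radius. *)
Lemma segment_unif_continuous {R : realType} (g : R -> R) (K e : R) :
  continuous g -> 0 < e ->
  exists2 r, 0 < r & forall x c, `|x| <= K -> `|c - x| < r -> `|g c - g x| <= e.
Proof.
move=> cg e0.
have /compact_near_coveringP cK : compact `[- K, K]%classic.
  exact: segment_compact.
have H : \forall r \near 0^'+, `[- K, K]%classic `<=`
    (fun x => forall c, `|c - x| < r -> `|g c - g x| <= e).
  apply: cK => x _.
  have /cvgrPdist_lt/(_ (e / 2)) := cg x.
  rewrite divr_gt0// => /(_ isT)[d /= d0 hd].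
  exists (ball x (d / 2), [set r | r < d / 2]) => /=.
    split; first by apply: nbhsx_ballx; rewrite divr_gt0.
    by apply: nbhs_right_lt; rewrite divr_gt0.
  move=> [y r] /= [xy rd] c cy.
  have h1 := hd y; have h2 := hd c; rewrite /ball/= in h1 h2.
  have xyd : `|x - y| < d by apply: lt_trans xy _; lra.
  have xcd : `|x - c| < d.
    have -> : x - c = (x - y) - (c - y) by lra.
    by apply: le_lt_trans (ler_normB _ _) _; rewrite /ball/= in xy; lra.
  have -> : g c - g y = (g x - g y) - (g x - g c) by lra.
  apply: le_trans (ler_normB _ _) _.
  by have := h1 xyd; have := h2 xcd; lra.
near (0 : R)^'+ => r.
exists r => // x c xK; apply: (near H r) => //.
by rewrite /= in_itv/= -ler_norml.
Unshelve. all: by end_near. Qed.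

(** * Gaussian kernels: smoothing and tightness *)

Section gaussian_kernel.
Context {R : realType}.
Notation mu := (@lebesgue_measure R).

(** Used in three ways: as the characteristic function of N(0,1) at s x, hence an average of cosines
    ([gker_Ex]); as the density of deviation 1 / s up to its peak ([normal_pdf_gker]); and as a
    continuous cut-off that tends to 1 as s tends to 0. *)
Definition gker (s x : R) := expR (- ((s * x) ^+ 2 / 2)).

Lemma gker_le1 s x : gker s x <= 1.
Proof. by rewrite -expR0 ler_expR oppr_le0 divr_ge0 ?sqr_ge0. Qed.

Lemma gker_ge0 s x : 0 <= gker s x. Proof. exact: expR_ge0. Qed.

Lemma measurable_gker s : measurable_fun setT (gker s).
Proof.
apply: measurableT_comp => //; apply: measurableT_comp => //.
apply: measurable_funM => //; apply: measurable_funX.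
exact: measurable_funM.
Qed.

Lemma bmeas_gker s : bmeas (gker s).
Proof.
split; first exact: measurable_gker.
by exists 1 => x; rewrite ger0_norm ?gker_le1 ?gker_ge0.
Qed.

Lemma continuous_gker s : continuous (gker s).
Proof.
move=> x; rewrite /gker; apply: (cvg_comp _ expR); last exact: continuous_expR.
apply: cvgN; apply: cvgMl; rewrite [X in _ --> X](_ : _ = (s * x) * (s * x)) ?expr2//.
rewrite [X in X @ _](_ : _ = fun x => (s * x) * (s * x)); last first.
  by apply/funext => u; rewrite expr2.
by apply: cvgM; apply: cvgM; [exact: cvg_cst|exact: cvg_id|exact: cvg_cst|exact: cvg_id].
Qed.

Lemma normal_pdf_gker (m s x : R) : s != 0 ->
  normal_pdf m s x = normal_peak s * gker s^-1 (x - m).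
Proof.
move=> s0; rewrite normal_pdfE// /normal_fun /gker; congr (_ * expR _).
by rewrite -mulr_natr; field.
Qed.

(** Beyond distance [r], the density of deviation s is compared with that of deviation 2 s, whose
    total mass is 1. The exponents differ by y = 3/8 (c - x)^2 / s^2, and exp(- y) <= 1 / y produces
    (s / r)^2. The constant collects 2 M from [g], 2 from the peaks and 8/3 from 1 / y, that is 32/3
    <= 11. *)
Lemma normal_smoothing (g : R -> R) (x M e r s : R) : measurable_fun setT g ->
  (forall c, `|g c| <= M) -> 0 <= e -> 0 < r -> 0 < s ->
  (forall c, `|c - x| < r -> `|g c - g x| <= e) ->
  `|Ex (normal_prob x s) g - g x| <= e + 11 * M * (s / r) ^+ 2.
Proof.
move=> mg gM e0 r0 s0 ge.
have bg : bmeas g by split=> //; exists M.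
have M0 : 0 <= M := le_trans (normr_ge0 _) (gM 0).
rewrite -{1}(Ex_cst (normal_prob x s) (g x)) -ExB//; last exact: bmeas_cst.
have bd : bmeas (fun c => g c - g x) by apply: bmeasB => //; exact: bmeas_cst.
apply: le_trans (Ex_norm (normal_prob x s) bd) _.
rewrite Ex_normal_prob; last exact: bmeas_norm.
have s20 : 2 * s != 0 by rewrite mulf_neq0 ?gt_eqF.
have i1 : mu.-integrable setT (fun c => (normal_pdf x s c)%:E).
  exact: integrable_normal_pdf.
have i2 : mu.-integrable setT (fun c => (normal_pdf x (2 * s) c)%:E).
  exact: integrable_normal_pdf.
have i3 := integrableZl measurableT e i1.
have i4 := integrableZl measurableT (11 * M * (s / r) ^+ 2) i2.
have I1 m t : \int[mu]_c normal_pdf m t c = 1 :> R.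
  by rewrite /Rintegral integral_normal_pdf.
have -> : e + 11 * M * (s / r) ^+ 2 = \int[mu]_c
    (e * normal_pdf x s c + 11 * M * (s / r) ^+ 2 * normal_pdf x (2 * s) c).
  by rewrite RintegralD// !RintegralZl// !I1 !mulr1.
have pt c : `|g c - g x| * normal_pdf x s c <=
    e * normal_pdf x s c + 11 * M * (s / r) ^+ 2 * normal_pdf x (2 * s) c.
  have p1 := normal_pdf_ge0 x s c; have p2 := normal_pdf_ge0 x (2 * s) c.
  have [cr|cr] := ltP `|c - x| r.
    rewrite -[leLHS]addr0 lerD//; first by rewrite ler_wpM2r// ge.
    by rewrite mulr_ge0// mulr_ge0 ?sqr_ge0// mulr_ge0.
  rewrite -[leLHS]add0r lerD//; first by rewrite mulr_ge0.
  have gg : `|g c - g x| <= 2 * M.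
    by apply: le_trans (ler_normB _ _) _; have := gM c; have := gM x; lra.
  apply: (@le_trans _ _ (2 * M * normal_pdf x s c)); first by rewrite ler_wpM2r.
  have peak2 : normal_peak s = 2 * normal_peak (2 * s).
    rewrite /normal_peak (_ : (2 * s) ^+ 2 * pi *+ 2 = 2 ^+ 2 * (s ^+ 2 * pi *+ 2)).
      by rewrite sqrtrM ?sqr_ge0// sqrtr_sqr ger0_norm// invfM mulrA divff ?mul1r.
    by rewrite -!(mulr_natr (_ * pi)); ring.
  rewrite !normal_pdf_gker ?(gt_eqF s0)// peak2.
  set k := normal_peak (2 * s); have k0 : 0 <= k by exact: normal_peak_ge0.
  have u0 : 0 < (c - x) ^+ 2 by rewrite -real_normK ?num_real// exprn_gt0// (lt_le_trans r0).
  have -> : gker s^-1 (c - x) =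
      expR (- (3 / 8 * (c - x) ^+ 2 / s ^+ 2)) * gker (2 * s)^-1 (c - x).
    rewrite /gker -expRD; congr expR; field.
    by rewrite gt_eqF.
  set y := 3 / 8 * _ / _.
  have y0 : 0 < y by rewrite /y divr_gt0 ?exprn_gt0// mulr_gt0// divr_gt0.
  have ey : expR (- y) <= 8 / 3 * (s / r) ^+ 2.
    apply: (@le_trans _ _ y^-1).
      rewrite expRN lef_pV2 ?posrE ?expR_gt0//.
      by have := expR_ge1Dx y; lra.
    have rc : r ^+ 2 <= (c - x) ^+ 2.
      by rewrite -(real_normK (num_real (c - x))) ler_pXn2r// ?nnegrE ltW.
    have r20 : 0 < r ^+ 2 by rewrite exprn_gt0.
    have s20' : 0 < s ^+ 2 by rewrite exprn_gt0.
    have -> : y^-1 = 8 / 3 * s ^+ 2 / (c - x) ^+ 2.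
      by rewrite /y; field; rewrite (gt_eqF s0) -sqrf_eq0 gt_eqF.
    have -> : 8 / 3 * (s / r) ^+ 2 = 8 / 3 * s ^+ 2 / r ^+ 2.
      by rewrite expr_div_n mulrA.
    apply: ler_wpM2l; last by rewrite lef_pV2 ?posrE.
    by rewrite ltW// mulr_gt0// divr_gt0.
  have g0 := gker_ge0 (2 * s)^-1 (c - x).
  set K := gker (2 * s)^-1 (c - x).
  have Mk : 0 <= 4 * M * (k * K) by rewrite !mulr_ge0.
  have sr : 0 <= M * (s / r) ^+ 2 * (k * K).
    by apply: mulr_ge0; apply: mulr_ge0 => //; exact: sqr_ge0.
  have := ler_wpM2l Mk ey; lra.
apply: le_Rintegral => //; last exact: (integrableD measurableT i3 i4).
have bn := bmeas_norm bd.
apply: (le_integrable _ _ _ (integrableZl measurableT (2 * M) i1)) => //.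
  apply/measurable_EFinP/measurable_funM; first by case: bn.
  exact: measurable_normal_pdf.
move=> c _ /=; rewrite lee_fin.
have p1 := normal_pdf_ge0 x s c.
rewrite normrM normr_id normrM (ger0_norm p1) ler_wpM2r//.
apply: le_trans (ler_norm _).
by apply: le_trans (ler_normB _ _) _; have := gM c; have := gM x; lra.
Qed.

Lemma gker_Ex (s x c : R) :
  gker s (x - c) = Ex (normal_prob 0 1) (fun z => cos (s * z * x + - (s * z * c))).
Proof.
have := Ex_cos_normal 0 (s * (x - c)); rewrite cos0 mulr1 /gker => <-.
by congr Ex; apply/funext => z; congr cos; ring.
Qed.

Lemma gker_le_half (l x : R) : 0 < l -> 2 / l <= `|x| -> gker l x <= 1 / 2.
Proof.
move=> l0 xl.
have lx : 4 <= (l * x) ^+ 2.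
  have l2 : 2 <= `|l * x| by rewrite normrM (gtr0_norm l0) -ler_pdivrMl// mulrC.
  by rewrite -(real_normK (num_real (l * x))); nra.
rewrite /gker expRN; have := expR_ge1Dx ((l * x) ^+ 2 / 2) => h.
rewrite -[leRHS]invrK lef_pV2 ?posrE ?expR_gt0// ?invr_gt0 ?divr_gt0//.
by rewrite div1r invrK; lra.
Qed.

(** Tightness is measured by a Gaussian cut-off instead of an interval because expectations of
    [gker] pass to the limit as soon as those of cosines do. *)
Lemma gker_tight {d} {S : measurableType d} (Q : probability S R) (V : S -> R) e :
  measurable_fun setT V -> 0 < e -> exists2 l : R, 0 < l & 1 - Ex Q (fun w => gker l (V w)) <= e.
Proof.
move=> mV e0.
have : Ex Q (fun w => gker n.+1%:R^-1 (V w)) @[n --> \oo] --> Ex Q (fun=> 1).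
  apply: (@Ex_cvg _ _ _ Q _ _ 1 set0) => //.
  - by move=> n; apply: (measurableT_comp (measurable_gker _)).
  - by move=> n t; rewrite ger0_norm ?gker_le1 ?gker_ge0.
  - move=> t _.
    have k1 : gker 1 0 = 1 :> R by rewrite /gker mulr0 expr0n mul0r oppr0 expR0.
    have ks n : gker n.+1%:R^-1 (V t) = gker 1 (n.+1%:R^-1 * V t).
      by rewrite /gker mul1r.
    have c0 : n.+1%:R^-1 * V t @[n --> \oo] --> 0.
      have : n.+1%:R^-1 * V t @[n --> \oo] --> 0 * V t.
        by apply: cvgM; [exact: cvg_harmonic|exact: cvg_cst].
      by rewrite mul0r.
    have : gker 1 (n.+1%:R^-1 * V t) @[n --> \oo] --> gker 1 0.
      by apply: continuous_cvg => //; exact: continuous_gker.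
    by rewrite k1 (funext ks).
rewrite Ex_cst => /cvgrPdist_le/(_ _ e0)[N _ /(_ N (leqnn _))] h.
by exists N.+1%:R^-1 => //; apply: le_trans (ler_norm _) h.
Qed.

End gaussian_kernel.

Section levy_continuity.
Context {d d'} {T : measurableType d} {S : measurableType d'} {R : realType}.
Variables (P : probability T R) (Q : probability S R).
Variables (Y : nat -> T -> R) (V : S -> R).
Hypothesis mY : forall n, measurable_fun setT (Y n).
Hypothesis mV : measurable_fun setT V.
Hypothesis cosY : forall t a, Ex P (fun w => cos (t * Y n w + a)) @[n --> \oo]
  --> Ex Q (fun w => cos (t * V w + a)).

(** The test functions for which convergence is established. Cosines belong to it by hypothesis, and
    it is enlarged by averaging over a parameter. *)
Let cls (f : R -> R) := bmeas f /\
  Ex P (fun w => f (Y n w)) @[n --> \oo] --> Ex Q (fun w => f (V w)).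

Let bmeas_comp {d0} {A : measurableType d0} (f : R -> R) (W : A -> R) :
  measurable_fun setT W -> bmeas f -> bmeas (fun w => f (W w)).
Proof.
by move=> mW [mf [M fM]]; split; [exact: measurableT_comp|exists M].
Qed.

(** Fubini moves the average over [a] outside both expectations; bounded convergence under [m] then
    passes to the limit for all [a] together. *)
Let cls_mix {d0} {A : measurableType d0} (m : probability A R)
    (F : A * R -> R) : bmeas F -> (forall a, cls (fun x => F (a, x))) ->
  cls (fun x => Ex m (fun a => F (a, x))).
Proof.
move=> bF cF; split; first exact: (bmeas_Ex1 m (normal_prob 0 1) bF).
have sw (d1 : measure_display) (B : measurableType d1) (L : probability B R) (W : B -> R) :
    measurable_fun setT W ->
    bmeas (fun a => Ex L (fun w => F (a, W w))) /\
    Ex L (fun w => Ex m (fun a => F (a, W w))) =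
    Ex m (fun a => Ex L (fun w => F (a, W w))).
  move=> mW; pose F' := fun aw : A * B => F (aw.1, W aw.2).
  have bF' : bmeas F'.
    case: bF => mF [M FM]; split; last by exists M => aw; exact: FM.
    apply: (measurableT_comp mF); apply: measurable_fun_pair.
      exact: measurable_fst.
    exact: (measurableT_comp mW measurable_snd).
  by split; [exact: (bmeas_Ex2 m L bF')|rewrite -(Ex_fubini m L bF')].
have [bV ->] := sw _ _ Q V mV.
under eq_fun do rewrite (sw _ _ P (Y _) (mY _)).2.
have [mF [M FM]] := bF.
apply: (@Ex_cvg _ _ _ m _ _ M set0) => //.
- by move=> n; have [[]] := sw _ _ P (Y n) (mY n).
- by case: bV.
- move=> n a; have b1 : bmeas (fun w => F (a, Y n w)).
    exact: (bmeas_comp (f := fun x => F (a, x)) (mY n) (bmeas_section2 bF a)).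
  apply: le_trans (Ex_norm P b1) _.
  rewrite -[leRHS](Ex_cst P M); apply: le_Ex => //; last exact: bmeas_cst.
  exact: bmeas_norm.
- by move=> a _; have [] := cF a.
Qed.

Let clsZ (c : R) f : cls f -> cls (fun x => c * f x).
Proof.
move=> [bf cf]; split; first by apply: bmeasM => //; exact: bmeas_cst.
have bV := bmeas_comp mV bf; rewrite ExZ//.
rewrite (_ : (fun n => _) = (fun n => c * Ex P (fun w => f (Y n w)))).
  exact: cvgMr.
by apply/funext => n; rewrite ExZ//; exact: bmeas_comp.
Qed.

Let measurable_cos : measurable_fun setT (@cos R).
Proof. by apply: continuous_measurable_fun; exact: continuous_cos. Qed.

Let cls_cos t a : cls (fun x => cos (t * x + a)).
Proof.
split; last exact: cosY.
split; last by exists 1 => x; rewrite ler_norml cos_geN1 cos_le1.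
apply: measurableT_comp => //; exact: measurable_funD.
Qed.

Let cls_gker s c : cls (fun x => gker s (x - c)).
Proof.
pose F := fun zx : R * R => cos (s * zx.1 * zx.2 + - (s * zx.1 * c)).
have bF : bmeas F.
  split; last by exists 1 => x; rewrite ler_norml cos_geN1 cos_le1.
  apply: measurableT_comp => //.
  have mf : measurable_fun setT (fun zx : R * R => s * zx.1).
    by apply: measurable_funM => //; exact: measurable_fst.
  apply: measurable_funD.
    by apply: measurable_funM => //; exact: measurable_snd.
  by apply: measurableT_comp => //; exact: measurable_funM.
have := cls_mix (normal_prob 0 1) bF _.
rewrite (_ : (fun _ => Ex _ _) = (fun x => gker s (x - c))); last first.
  by apply/funext => x; rewrite gker_Ex.
by apply => z; exact: (cls_cos (s * z) (- (s * z * c))).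
Qed.

(** Up to a constant the cut-off [gker l] is the density of N(0, 1 / l^2), so the smoothing of f
    times [gker l] is a mixture, over a probability in [c], of bumps in [x] centred at [c]. Without
    the cut-off the weight would be Lebesgue measure. *)
Let cls_smooth (f : R -> R) (l s : R) : bmeas f -> l != 0 -> s != 0 ->
  cls (fun x => Ex (normal_prob x s) (fun c => f c * gker l c)).
Proof.
move=> bf l0 s0; have [mf [M fM]] := bf.
pose F := fun cx : R * R => f cx.1 * gker s^-1 (cx.1 - cx.2).
have bF : bmeas F.
  have m1 : measurable_fun setT (fun cx : R * R => f cx.1).
    by apply: (measurableT_comp mf); exact: measurable_fst.
  split.
    apply: measurable_funM => //; apply: (measurableT_comp (measurable_gker _)).
    by apply: measurable_funB; [exact: measurable_fst|exact: measurable_snd].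
  exists M => cx; rewrite /F normrM (ger0_norm (gker_ge0 _ _)).
  by rewrite (le_trans _ (fM cx.1))// ler_piMr// gker_le1.
have cF c : cls (fun x => F (c, x)).
  have := clsZ (f c) (cls_gker s^-1 c).
  rewrite /F (_ : (fun x : R => _ * _) = (fun x => f c * gker s^-1 (c - x)))//.
  apply/funext => x; congr (_ * _); rewrite /gker; congr expR; ring.
have := clsZ (normal_peak s / normal_peak l^-1) (cls_mix (normal_prob 0 l^-1) bF cF).
rewrite (_ : (fun x : R => _ * Ex _ _) =
  (fun x => Ex (normal_prob x s) (fun c => f c * gker l c)))//.
apply/funext => x; rewrite -ExZ; last exact: bmeas_section1.
rewrite !Ex_normal_prob.
apply: eq_Rintegral => c _; rewrite /F/= !normal_pdf_gker ?invr_eq0// invrK subr0.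
by field; rewrite gt_eqF// normal_peak_gt0 ?invr_eq0.
- by apply: bmeasM => //; exact: bmeas_gker.
- by apply: bmeasM; [exact: bmeas_cst|exact: bmeas_section1].
Qed.

Theorem levy_cvg_in_law : cvg_in_law P Y Q V.
Proof.
move=> f cf [M fM].
have M0 : 0 <= M := le_trans (normr_ge0 _) (fM 0).
have mf : measurable_fun setT f by exact: continuous_measurable_fun.
have bf : bmeas f by split=> //; exists M.
rewrite ExE; last exact: bmeas_comp.
under eq_fun do rewrite (ExE _ (bmeas_comp (mY _) bf)).
apply: cvg_EFin; first exact: nearW.
apply/cvgrPdist_le => e e0.
(* The cut-off loses at most [e1] under [V] and [2 * e1] under [Y n], each weighted by 5 M: 15 M e1
   in all, besides 5 e1 from the other terms. *)
pose e1 := e / (15 * (M + 1)).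
have M10 : 0 < 15 * (M + 1) by rewrite mulr_gt0// ltr_wpDl.
have e10 : 0 < e1 by rewrite divr_gt0.
have [l l0 hl] := gker_tight Q mV e10.
pose g := fun x => f x * gker l x.
have cg : continuous g by move=> x; apply: cvgM; [exact: cf|exact: continuous_gker].
have gM x : `|g x| <= M.
  rewrite /g normrM (ger0_norm (gker_ge0 _ _)).
  by rewrite (le_trans _ (fM x))// ler_piMr// gker_le1.
have mg : measurable_fun setT g by exact: continuous_measurable_fun.
have bg : bmeas g by split=> //; exists M.
have [r r0 hr] := segment_unif_continuous (2 / l) cg e10.
(* This gives both u <= 1 and 11 M u <= e1, hence 11 M u^2 <= e1 even when M = 0. *)
pose u := e1 / (11 * (M + 1) + e1).
have den0 : 0 < 11 * (M + 1) + e1 by rewrite addr_gt0// mulr_gt0// ltr_wpDl.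
have u0 : 0 < u by rewrite divr_gt0.
have uE : u * (11 * (M + 1) + e1) = e1 by rewrite mulfVK// gt_eqF.
have hu : 11 * M * u ^+ 2 <= e1 by nra.
pose s := r * u.
have s0 : 0 < s by rewrite mulr_gt0.
have sru : s / r = u by rewrite /s mulrAC divff ?mul1r// gt_eqF.
pose gs x := Ex (normal_prob x s) g.
have [bgs cgs] : cls gs by apply: cls_smooth => //; rewrite gt_eqF.
(* Smoothing is controlled only for [|x| <= 2 / l]. Beyond, [gker l x <= 1 / 2], so the trivial
   bound 2 M is at most 4 M (1 - gker l x); replacing [f] by [g] costs one more M (1 - gker l x). *)
have pt x : `|f x - gs x| <= 2 * e1 + 5 * M * (1 - gker l x).
  have k0 := gker_ge0 l x; have k1 := gker_le1 l x.
  have fg : `|f x - g x| <= M * (1 - gker l x).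
    rewrite (_ : f x - g x = f x * (1 - gker l x)); last by rewrite /g; ring.
    by rewrite normrM ler_pM// ger0_norm// subr_ge0.
  have ggs : `|gs x - g x| <= 2 * e1 + 4 * M * (1 - gker l x).
    have [xl|xl] := leP `|x| (2 / l).
      have := @normal_smoothing _ g x M e1 r s mg gM (ltW e10) r0 s0
        (fun c => hr x c xl).
      rewrite sru => h; apply: le_trans h _.
      rewrite -[leLHS]addr0 lerD//; first by lra.
      by rewrite !mulr_ge0// subr_ge0.
    have gsM : `|gs x| <= M.
      apply: le_trans (Ex_norm (normal_prob x s) bg) _.
      rewrite -[leRHS](Ex_cst (normal_prob x s) M); apply: le_Ex => //.
        exact: bmeas_norm.
      exact: bmeas_cst.
    have kh := gker_le_half l0 (ltW xl).
    apply: le_trans (ler_normB _ _) _.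
    have := gM x; nra.
  rewrite (_ : f x - gs x = (f x - g x) - (gs x - g x)); last by ring.
  apply: le_trans (ler_normB _ _) _; lra.
have bk := bmeas_gker l.
have close (d1 : measure_display) (B : measurableType d1) (L : probability B R)
    (W : B -> R) : measurable_fun setT W ->
    `|Ex L (fun w => f (W w)) - Ex L (fun w => gs (W w))| <=
    2 * e1 + 5 * M * (1 - Ex L (fun w => gker l (W w))).
  move=> mW; have bfW := bmeas_comp mW bf; have bgW := bmeas_comp mW bgs.
  have bkW := bmeas_comp mW bk.
  have b1 : bmeas (fun w => 1 - gker l (W w)) by apply: bmeasB => //; exact: bmeas_cst.
  have b2 : bmeas (fun w => 5 * M * (1 - gker l (W w))).
    by apply: bmeasM => //; exact: bmeas_cst.
  rewrite -ExB//; apply: le_trans (Ex_norm L (bmeasB bfW bgW)) _.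
  have -> : 2 * e1 + 5 * M * (1 - Ex L (fun w => gker l (W w))) =
      Ex L (fun w => 2 * e1 + 5 * M * (1 - gker l (W w))).
    rewrite ExD//; last exact: bmeas_cst.
    rewrite Ex_cst ExZ// ExB//; last exact: bmeas_cst.
    by rewrite Ex_cst.
  apply: le_Ex => [||w]; last exact: pt.
    exact/bmeas_norm/bmeasB.
  by apply: bmeasD => //; exact: bmeas_cst.
have ck : Ex P (fun w => gker l (Y n w)) @[n --> \oo] --> Ex Q (fun w => gker l (V w)).
  have [_] := cls_gker l 0; under eq_fun do under [X in Ex P X]eq_fun do rewrite subr0.
  by under [X in _ --> Ex Q X]eq_fun do rewrite subr0.
move/cvgrPdist_le: ck => /(_ _ e10) ck.
move/cvgrPdist_le: cgs => /(_ _ e10) cgs'.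
near=> n.
have h1 := close _ _ P _ (mY n); have h2 := close _ _ Q _ mV.
have h3 : `|Ex Q (fun w => gker l (V w)) - Ex P (fun w => gker l (Y n w))| <= e1.
  by near: n.
have h4 : `|Ex Q (fun w => gs (V w)) - Ex P (fun w => gs (Y n w))| <= e1.
  by near: n.
move: h1 h2 h3 h4 hl; set a1 := Ex P _; set a2 := Ex P _; set a3 := Ex P _.
set b1 := Ex Q _; set b2 := Ex Q _; set b3 := Ex Q _ => h1 h2 h3 h4 hl.
have ee : e = 15 * e1 + 15 * (M * e1).
  by rewrite -[e in LHS](mulfVK (lt0r_neq0 M10)) -/e1; ring.
have h3' : 1 - a3 <= 2 * e1 by move: h3; rewrite ler_norml => /andP[]; lra.
have h5 : M * (1 - a3) <= M * (2 * e1) by rewrite ler_wpM2l.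
have h6 : M * (1 - b3) <= M * e1 by rewrite ler_wpM2l.
rewrite (_ : b1 - a1 = (b1 - b2) + (b2 - a2) - (a1 - a2)); last by ring.
apply: le_trans (ler_normB _ _) _.
have := ler_normD (b1 - b2) (b2 - a2); lra.
Unshelve. all: by end_near. Qed.

End levy_continuity.

(** * One-step estimates for the urn chain *)

Section taylor_bounds.
Context {R : realType}.

(** Each Taylor bound below feeds the next through this mean value form, which covers both signs of
    [x]; the resulting constants 1/2 are crude but sufficient. *)
Lemma mvt_at0 (f df : R -> R) (x : R) :
  (forall y : R, is_derive y 1 f (df y)) -> f 0 = 0 ->
  exists2 c, `|c| <= `|x| & f x = df c * x.
Proof.
move=> dfE f0.
have cf : continuous f.
  by move=> y; apply/differentiable_continuous/derivable1_diffP; have [] := dfE y.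
have [x0|x0|->] := ltgtP x 0.
- have [c /[!in_itv]/= /andP[xc c0] e] := @MVT _ f df x 0 x0 (fun y _ => dfE y)
    (continuous_subspaceT cf).
  exists c; first by rewrite !ltr0_norm// lerN2 ltW.
  by move: e; rewrite f0 !sub0r mulrN => /oppr_inj.
- have [c /[!in_itv]/= /andP[xc c0] e] := @MVT _ f df 0 x x0 (fun y _ => dfE y)
    (continuous_subspaceT cf).
  exists c; first by rewrite !gtr0_norm// ltW.
  by move: e; rewrite f0 !subr0.
- by exists 0; rewrite ?f0 ?mulr0.
Qed.

Lemma norm_sin_le (x : R) : `|sin x| <= `|x|.
Proof.
have [c _ ->] := @mvt_at0 sin cos x (fun y => is_derive_sin y) (sin0 R).
by rewrite normrM ler_piMl// ler_norml cos_geN1 cos_le1.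
Qed.

Lemma norm_cos_sub1 (x : R) : `|cos x - 1| <= x ^+ 2 / 2.
Proof.
have h := norm_sin_le (x / 2).
have -> : cos x - 1 = - (sin (x / 2) ^+ 2 *+ 2).
  rewrite {1}(_ : x = (x / 2) *+ 2); last by rewrite -mulr_natr mulfVK// pnatr_eq0.
  by rewrite cos_mulr2n cos2sin2 !mulr2n; ring.
rewrite normrN ger0_norm ?mulrn_wge0 ?sqr_ge0//.
rewrite -(real_normK (num_real (sin _))) -(real_normK (num_real x)).
move: h; rewrite normrM (ger0_norm (x := 2^-1)) ?invr_ge0//.
have := normr_ge0 (sin (x / 2)); rewrite -mulr_natr; nra.
Qed.

Lemma norm_sin_sub (x : R) : `|sin x - x| <= `|x| ^+ 3 / 2.
Proof.
have [c cx ->] : exists2 c, `|c| <= `|x| & sin x - x = (cos c - 1) * x.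
  apply: (@mvt_at0 (fun x => sin x - x) (fun x => cos x - 1)).
  by rewrite sin0 subrr.
rewrite normrM; have := norm_cos_sub1 c.
rewrite -(real_normK (num_real c)) => h.
rewrite [leRHS](_ : _ = `|x| ^+ 2 / 2 * `|x|); last by ring.
rewrite ler_wpM2r//; apply: le_trans h _.
by rewrite ler_pM2r// ler_pXn2r.
Qed.

Lemma norm_cos_sub2 (x : R) : `|cos x - 1 + x ^+ 2 / 2| <= x ^+ 4 / 2.
Proof.
have [c cx ->] : exists2 c, `|c| <= `|x| &
    cos x - 1 + x ^+ 2 / 2 = (c - sin c) * x.
  apply: (@mvt_at0 (fun x => cos x - 1 + x ^+ 2 / 2) (fun x => x - sin x)) => [y|].
    by apply: is_derive_eq; rewrite /GRing.scale/=; lra.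
  by rewrite cos0 subrr expr0n/= mul0r addr0.
rewrite normrM distrC; have := norm_sin_sub c => h.
rewrite [leRHS](_ : _ = `|x| ^+ 3 / 2 * `|x|); last first.
  by rewrite -[x ^+ 4]ger0_norm ?exprn_even_ge0// normrX; ring.
rewrite ler_wpM2r//; apply: le_trans h _.
by rewrite ler_pM2r// ler_pXn2r.
Qed.

Lemma expRN_bounds (y : R) : 0 <= y ->
  [/\ 0 <= expR (- y), expR (- y) <= 1, 0 <= expR (- y) - 1 + y &
      expR (- y) - 1 + y <= y ^+ 2].
Proof.
move=> y0; split.
- exact: expR_ge0.
- by rewrite -expR0 ler_expR oppr_le0.
- by have := expR_ge1Dx (- y); lra.
- have e1 := expR_ge1Dx y.
  have : expR (- y) <= (1 + y)^-1.
    by rewrite expRN lef_pV2// posrE ?expR_gt0// ltr_pwDl.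
  have yy : 0 < 1 + y by rewrite ltr_pwDl.
  move=> h; have : (1 + y)^-1 <= 1 - y + y ^+ 2.
    rewrite -[leLHS]mul1r ler_pdivrMr//.
    have : 0 <= y ^+ 3 by rewrite exprn_ge0.
    nra.
  lra.
Qed.

(** Here q is the probability of an increment, t = b / a_(k+1) and e = p / k. A jump costs q t^2 at
    second order, half from the cosine and half from the Gaussian factor, and this is what the
    exponent on the other side releases; the first-order terms q t sin c agree as well. All
    remainders carry the factor q t^2. *)
Lemma one_step_taylor (c q t e : R) : 0 <= q <= 1 -> 0 <= e <= 1 ->
  `|(1 - q) * cos c + q * (expR (- (t ^+ 2 / 2)) * cos (c - t))
    - expR (- (q * t ^+ 2 * (1 + e / 2))) * cos (c - q * t)|
  <= 8 * (q * t ^+ 2 * (`|t| + t ^+ 2 + q + e)).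
Proof.
move=> /andP[q0 q1] /andP[e0 e1].
set u := t ^+ 2 / 2; set y := q * t ^+ 2 * _.
set T := `|t|; have T0 : 0 <= T by exact: normr_ge0.
have tT : t ^+ 2 = T ^+ 2 by rewrite -(real_normK (num_real t)).
have u0 : 0 <= u by rewrite divr_ge0 ?sqr_ge0.
have y0 : 0 <= y.
  apply: mulr_ge0; first by apply: mulr_ge0 => //; exact: sqr_ge0.
  by rewrite addr_ge0// divr_ge0.
have yle : y <= 3 / 2 * (q * T ^+ 2).
  rewrite /y tT; have : 0 <= q * T ^+ 2 by rewrite mulr_ge0// exprn_ge0.
  nra.
have [Eu0 Eu1 Eu2 Eu3] := expRN_bounds u0.
have [Ey0 Ey1 Ey2 Ey3] := expRN_bounds y0.
have st := norm_sin_sub t; have ct := norm_cos_sub2 t.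
have sv := norm_sin_sub (q * t); have cv := norm_cos_sub1 (q * t).
have nv : `|q * t| = q * T by rewrite normrM (ger0_norm q0).
rewrite nv in sv.
have T3 : 0 <= T ^+ 3 by rewrite exprn_ge0.
have T4 : t ^+ 4 = T ^+ 4 by rewrite -[LHS]ger0_norm ?exprn_even_ge0// normrX.
have q3 : q ^+ 3 <= q by rewrite exprS ler_piMr// exprn_ile1.
have q2 : q ^+ 2 <= q by rewrite expr2 ler_piMr.
have eu : `|expR (- u) - 1| <= u by rewrite ler_norml; lra.
have ey : `|expR (- y) - 1| <= y by rewrite ler_norml; lra.
set Xu := expR (- u) in Eu0 Eu1 Eu2 Eu3 eu *.
set Xy := expR (- y) in Ey0 Ey1 Ey2 Ey3 ey *.
have E1 : `|Xu * cos t - (1 - t ^+ 2)| <= T ^+ 4.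
  have -> : Xu * cos t - (1 - t ^+ 2) =
      Xu * (cos t - 1 + u) + ((Xu - 1 + u) - u * (Xu - 1)) by rewrite /u; field.
  apply: le_trans (ler_normD _ _) _.
  have h1 : `|Xu * (cos t - 1 + u)| <= T ^+ 4 / 2.
    by rewrite normrM (ger0_norm Eu0) -T4 (le_trans _ ct)// ler_piMl.
  have h2 : `|(Xu - 1 + u) - u * (Xu - 1)| <= u ^+ 2 + u ^+ 2.
    apply: le_trans (ler_normB _ _) _; rewrite (ger0_norm Eu2) lerD//.
    by rewrite normrM (ger0_norm u0) expr2 ler_wpM2l.
  have h3 : u ^+ 2 = T ^+ 4 / 4 by rewrite /u tT; field.
  lra.
have E2 : `|Xy * cos (q * t) - (1 - y)| <= q ^+ 2 * T ^+ 2 / 2 + 9 / 4 * (q * T ^+ 4).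
  have -> : Xy * cos (q * t) - (1 - y) =
      Xy * (cos (q * t) - 1) + (Xy - 1 + y) by ring.
  apply: le_trans (ler_normD _ _) _; rewrite (ger0_norm Ey2).
  have h1 : `|Xy * (cos (q * t) - 1)| <= q ^+ 2 * T ^+ 2 / 2.
    rewrite normrM (ger0_norm Ey0) -tT -exprMn (le_trans _ cv)// ler_piMl//.
  have h2 : y ^+ 2 <= 9 / 4 * (q ^+ 2 * T ^+ 4).
    apply: (@le_trans _ _ ((3 / 2 * (q * T ^+ 2)) ^+ 2)).
      by rewrite ler_pXn2r// nnegrE (le_trans y0).
    by rewrite le_eqVlt; apply/orP; left; apply/eqP; field.
  have h3 : q ^+ 2 * T ^+ 4 <= q * T ^+ 4 by rewrite ler_wpM2r// exprn_ge0.
  lra.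
have E3 : `|Xu * sin t - t| <= T ^+ 3.
  have -> : Xu * sin t - t = Xu * (sin t - t) + t * (Xu - 1) by ring.
  apply: le_trans (ler_normD _ _) _.
  have h1 : `|Xu * (sin t - t)| <= T ^+ 3 / 2.
    by rewrite normrM (ger0_norm Eu0) (le_trans _ st)// ler_piMl.
  have h2 : `|t * (Xu - 1)| <= T * u by rewrite normrM ler_wpM2l.
  have h3 : T * u = T ^+ 3 / 2 by rewrite /u tT; field.
  lra.
have E4 : `|Xy * sin (q * t) - q * t| <= 2 * (q * T ^+ 3).
  have -> : Xy * sin (q * t) - q * t =
    Xy * (sin (q * t) - q * t) + q * t * (Xy - 1) by ring.
  apply: le_trans (ler_normD _ _) _.
  have h1 : `|Xy * (sin (q * t) - q * t)| <= q * T ^+ 3 / 2.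
    rewrite normrM (ger0_norm Ey0); apply: (@le_trans _ _ ((q * T) ^+ 3 / 2)).
      by rewrite (le_trans _ sv)// ler_piMl.
    by rewrite exprMn ler_pM2r// ler_wpM2r.
  have h2 : `|q * t * (Xy - 1)| <= q * T * y.
    by rewrite normrM nv ler_wpM2l// mulr_ge0.
  have h3 : q * T * y <= 3 / 2 * (q ^+ 2 * T ^+ 3).
    apply: (@le_trans _ _ (q * T * (3 / 2 * (q * T ^+ 2)))).
      by rewrite ler_wpM2l// mulr_ge0.
    by rewrite le_eqVlt; apply/orP; left; apply/eqP; field.
  have h4 : q ^+ 2 * T ^+ 3 <= q * T ^+ 3 by rewrite ler_wpM2r.
  lra.
rewrite !cosB.
(* [A] and [D] are the coefficients of cos c and sin c, written so that the leading terms q t^2 and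
   q t have already cancelled. *)
pose A := q * T ^+ 2 * e / 2 + q * (Xu * cos t - (1 - t ^+ 2))
          - (Xy * cos (q * t) - (1 - y)).
pose D := q * (Xu * sin t - t) - (Xy * sin (q * t) - q * t).
have -> : (1 - q) * cos c + q * (Xu * (cos c * cos t + sin c * sin t)) -
    Xy * (cos c * cos (q * t) + sin c * sin (q * t)) = A * cos c + D * sin c.
  by rewrite /A /D /y tT; field.
apply: le_trans (ler_normD _ _) _.
have nA : `|A| <= q * T ^+ 2 * e / 2 + q * T ^+ 4 +
    (q ^+ 2 * T ^+ 2 / 2 + 9 / 4 * (q * T ^+ 4)).
  apply: le_trans (ler_normB _ _) _; apply: lerD => //.
  apply: le_trans (ler_normD _ _) _; apply: lerD.
    by rewrite ger0_norm// divr_ge0// mulr_ge0// mulr_ge0// exprn_ge0.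
  by rewrite normrM (ger0_norm q0) ler_wpM2l.
have nD : `|D| <= q * T ^+ 3 + 2 * (q * T ^+ 3).
  apply: le_trans (ler_normB _ _) _; apply: lerD => //.
  by rewrite normrM (ger0_norm q0) ler_wpM2l.
have nAc : `|A * cos c| <= `|A|.
  by rewrite normrM ler_piMr// ler_norml cos_geN1 cos_le1.
have nDs : `|D * sin c| <= `|D|.
  by rewrite normrM ler_piMr// ler_norml sin_geN1 sin_le1.
have p1 : 0 <= q * T ^+ 2 * e by rewrite mulr_ge0// mulr_ge0// exprn_ge0.
have p2 : 0 <= q * T ^+ 4 by rewrite mulr_ge0// exprn_ge0.
have p3 : 0 <= q ^+ 2 * T ^+ 2 by rewrite mulr_ge0// exprn_ge0.
have p4 : 0 <= q * T ^+ 3 by rewrite mulr_ge0.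
rewrite tT; lra.
Qed.

End taylor_bounds.

(** * The transition operator of the urn and the error supermartingale *)

Section urn_kernel.
Context {R : realType}.
Variable p : R.
Hypothesis p01 : 0 < p < 1.

(** Conditional mean of f(H_(k+1)) given H_k = h: the draw hits a 1 with probability h / k and is
    copied with probability p. *)
Definition urnK (k : nat) (f : nat -> R) (h : nat) : R :=
  (1 - p * h%:R / k%:R) * f h + p * h%:R / k%:R * f h.+1.

Fixpoint urnKs (k m : nat) (f : nat -> R) : nat -> R :=
  if m is m'.+1 then urnK k (urnKs k.+1 m' f) else f.

Lemma urn_prob01 k h : (0 < k)%N -> (h <= k)%N -> 0 <= p * h%:R / k%:R <= 1.
Proof.
move=> k0 hk; case/andP: p01 => p0 p1.
have kR : 0 < k%:R :> R by rewrite ltr0n.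
rewrite divr_ge0 ?mulr_ge0 ?(ltW p0)//= ler_pdivrMr// mul1r.
rewrite -[leRHS]mul1r; apply: ler_pM => //; first exact: ltW.
  exact: ltW.
by rewrite ler_nat.
Qed.

Lemma le_urnK k f g h : (0 < k)%N -> (h <= k)%N -> f h <= g h ->
  f h.+1 <= g h.+1 -> urnK k f h <= urnK k g h.
Proof.
move=> k0 hk fg fg1; have /andP[q0 q1] := urn_prob01 k0 hk.
by rewrite /urnK lerD// ler_wpM2l// subr_ge0.
Qed.

Lemma norm_urnK k f h : (0 < k)%N -> (h <= k)%N ->
  `|urnK k f h| <= urnK k (fun x => `|f x|) h.
Proof.
move=> k0 hk; have /andP[q0 q1] := urn_prob01 k0 hk.
apply: le_trans (ler_normD _ _) _; rewrite /urnK.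
have -> : `|(1 - p * h%:R / k%:R) * f h| = (1 - p * h%:R / k%:R) * `|f h|.
  by rewrite normrM ger0_norm// subr_ge0.
by rewrite normrM (ger0_norm q0).
Qed.

Lemma norm_urnKs k m f h M : (0 < k)%N -> (h <= k)%N -> (forall x, `|f x| <= M) ->
  `|urnKs k m f h| <= M.
Proof.
elim: m k h => [|m IH] k h k0 hk fM //=.
apply: le_trans (norm_urnK _ k0 hk) _.
apply: (@le_trans _ _ (urnK k (fun=> M) h)).
  by apply: le_urnK => //; apply: IH => //; exact: leqW.
by rewrite /urnK -mulrDl subrK mul1r.
Qed.

(** [B k h] pays for the error of step [k] and, through its own mean after the step, for all later
    errors. This bounds the accumulated error uniformly in [m]. *)
Lemma urnKs_approx (F B : nat -> nat -> R) k m h :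
  (forall k h, (0 < k)%N -> (h <= k)%N -> 0 <= B k h) ->
  (forall k h, (0 < k)%N -> (h <= k)%N ->
    `|urnK k (F k.+1) h - F k h| + urnK k (B k.+1) h <= B k h) ->
  (0 < k)%N -> (h <= k)%N -> `|urnKs k m (F (k + m)%N) h - F k h| <= B k h.
Proof.
move=> B0 FB; elim: m k h => [|m IH] k h k0 hk /=.
  by rewrite addn0 subrr normr0 B0.
apply: le_trans (FB k h k0 hk).
rewrite addnS -addSn.
set G := urnKs _ _ _.
have -> : urnK k G h - F k h = urnK k (fun x => G x - F k.+1 x) h +
    (urnK k (F k.+1) h - F k h) by rewrite /urnK; ring.
rewrite addrC; apply: le_trans (ler_normD _ _) _; rewrite lerD2l.
apply: le_trans (norm_urnK _ k0 hk) _.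
by apply: le_urnK => //; apply: IH => //; exact: leqW.
Qed.

Variable a : nat -> R.
Hypothesis a_gt0 : forall k, (0 < k)%N -> 0 < a k.
Hypothesis aS : forall k, (0 < k)%N -> a k.+1 = a k * (1 + p / k%:R).

Definition urnF (b c : R) (k h : nat) : R :=
  expR (- ((b / a k) ^+ 2 * h%:R / 2)) * cos (c - b / a k * h%:R).

(** The one-step errors have the orders e h T^3, e h T^4 and e^2 h (h + 1) T^2, with e = p / k and T
    = |b| / a_(k+1). The mean of h grows by 1 + e while the cube and fourth power of 1 / a_k shrink
    faster, which covers the first two. The mean of h (h + 1) grows by exactly 1 + 2 e, nearly
    cancelled by the square of 1 / a_k, so the decrease of 1 / k has to cover the third. *)
Definition urnB (b : R) (k h : nat) : R :=
  8 * ((`|b| / a k) ^+ 3 * h%:R + (`|b| / a k) ^+ 4 * h%:R +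
       2 * (`|b| / a k) ^+ 2 * (h%:R * (h%:R + 1)) / k%:R).

Lemma urnF_step b c k h (t := b / a k.+1) (q := p * h%:R / k%:R) :
  (0 < k)%N -> (h <= k)%N ->
  `|urnK k (urnF b c k.+1) h - urnF b c k h| <=
  8 * (q * t ^+ 2 * (`|t| + t ^+ 2 + q + p / k%:R)).
Proof.
move=> k0 hk; have q01 := urn_prob01 k0 hk; case/andP: p01 => p0 p1.
have kR : 0 < k%:R :> R by rewrite ltr0n.
have e01 : 0 <= p / k%:R <= 1.
  have := urn_prob01 k0 k0; rewrite mulr1; exact.
have bt : b / a k = t * (1 + p / k%:R).
  rewrite /t aS// invfM mulrA mulfVK// gt_eqF//.
  by case/andP: e01 => ? _; rewrite ltr_pwDl.
have qe : q = p / k%:R * h%:R by rewrite /q; ring.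
have := one_step_taylor (c - t * h%:R) t q01 e01.
rewrite -/q; set Z := 8 * _; rewrite /urnK /urnF -/q -/t bt.
set x := h%:R in qe *.
pose E := expR (- (t ^+ 2 * x / 2)).
have -> : expR (- (t ^+ 2 * h.+1%:R / 2)) = E * expR (- (t ^+ 2 / 2)).
  by rewrite -expRD /E /x -natr1; congr expR; field.
(* With e = p / k, (1 + e)^2 = 1 + 2 e (1 + e / 2): this is the source of the factor 1 + e / 2 in
   [one_step_taylor]. *)
have -> : expR (- ((t * (1 + p / k%:R)) ^+ 2 * x / 2)) =
    E * expR (- (q * t ^+ 2 * (1 + p / k%:R / 2))).
  by rewrite -expRD /E qe; congr expR; field; rewrite gt_eqF.
have -> : c - t * h.+1%:R = c - t * x - t by rewrite /x -natr1; ring.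
have -> : c - t * (1 + p / k%:R) * x = c - t * x - q * t by rewrite qe; ring.
move=> h1.
rewrite -/E; set L := (X in `|X| <= _) in h1.
rewrite [X in `|X|](_ : _ = E * L); last by rewrite /L; ring.
rewrite normrM ger0_norm ?expR_ge0//.
apply: le_trans h1; rewrite ler_piMl// -expR0 ler_expR oppr_le0 divr_ge0//.
by rewrite mulr_ge0 ?sqr_ge0.
Qed.

Lemma urnB_ge0 b k h : (0 < k)%N -> 0 <= urnB b k h.
Proof.
move=> k0; rewrite /urnB; set w := _ / _.
have w0 : 0 <= w by rewrite divr_ge0// ltW// a_gt0.
have wn n : 0 <= w ^+ n * h%:R by rewrite mulr_ge0// exprn_ge0.
apply: mulr_ge0 => //; apply: addr_ge0; first exact: addr_ge0.
apply: divr_ge0 => //; apply: mulr_ge0; last by apply: mulr_ge0 => //; exact: addr_ge0.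
by apply: mulr_ge0 => //; exact: exprn_ge0.
Qed.

Lemma urnB_step b c k h : (0 < k)%N -> (h <= k)%N ->
  `|urnK k (urnF b c k.+1) h - urnF b c k h| + urnK k (urnB b k.+1) h <=
  urnB b k h.
Proof.
move=> k0 hk; have := urnF_step b c k0 hk; have /andP[p0 p1] := p01.
have kR : 1 <= k%:R :> R by rewrite ler1n.
have k1R : 0 < k%:R :> R by rewrite ltr0n.
set e := p / k%:R.
have e0 : 0 <= e by rewrite divr_ge0// ltW.
have ek : e <= k%:R^-1 by rewrite /e ler_piMl ?invr_ge0// ltW.
have ek1 : k%:R^-1 <= 1 :> R by rewrite invf_le1.
have a1 : 0 < a k.+1 by exact: a_gt0.
set T := `|b / a k.+1|; have T0 : 0 <= T by exact: normr_ge0.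
have tT : (b / a k.+1) ^+ 2 = T ^+ 2 by rewrite -(real_normK (num_real _)).
have bT : `|b| / a k.+1 = T by rewrite /T normrM normfV (gtr0_norm a1).
have bk : `|b| / a k = T * (1 + e).
  rewrite -bT aS// -/e invfM mulrA mulfVK// gt_eqF//.
  by rewrite ltr_pwDl.
rewrite tT /urnK /urnB bk bT; set x := h%:R.
have x0 : 0 <= x :> R by exact: ler0n.
have -> : p * x / k%:R = e * x by rewrite /e; ring.
have -> : h.+1%:R = x + 1 by rewrite natr1.
set y := k%:R^-1 in ek ek1 *; set z := k.+1%:R^-1.
have y0 : 0 < y by rewrite invr_gt0.
have z0 : 0 < z by rewrite invr_gt0.
have yz : y - z = y * z by rewrite /y /z -natr1; field; rewrite natr1 !pnatr_eq0 /= -lt0n.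
have zy : y <= 2 * z.
  by rewrite /y /z -div1r ler_pdivrMr// mulrAC ler_pdivlMr// mul1r -natr1; lra.
move=> h1; apply: le_trans (lerD h1 (lexx _)) _.
have T3 : 0 <= T ^+ 3 * x by rewrite mulr_ge0// exprn_ge0.
have T4 : 0 <= T ^+ 4 * x by rewrite mulr_ge0// exprn_ge0.
have T2 : 0 <= T ^+ 2 * x by rewrite mulr_ge0// exprn_ge0.
have i3 : e * x * T ^+ 3 + T ^+ 3 * x * (1 + e) <= (T * (1 + e)) ^+ 3 * x.
  rewrite -subr_ge0 [X in 0 <= X](_ : _ =
    (T ^+ 3 * x) * (e + 3 * e ^+ 2 + e ^+ 3)); last by ring.
  by apply: mulr_ge0 => //; rewrite !addr_ge0// ?exprn_ge0// mulr_ge0// exprn_ge0.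
have i4 : e * x * T ^+ 4 + T ^+ 4 * x * (1 + e) <= (T * (1 + e)) ^+ 4 * x.
  rewrite -subr_ge0 [X in 0 <= X](_ : _ = (T ^+ 4 * x) *
    (2 * e + 6 * e ^+ 2 + 4 * e ^+ 3 + e ^+ 4)); last by ring.
  by apply: mulr_ge0 => //; rewrite !addr_ge0// ?exprn_ge0// mulr_ge0// exprn_ge0.
have i2 : e * x * T ^+ 2 * (e * x + e) +
    2 * T ^+ 2 * (x * (x + 1) * (1 + 2 * e)) * z <=
    2 * (T * (1 + e)) ^+ 2 * (x * (x + 1)) * y.
  (* The gain 2 (y - z) = 2 y z from 1 / k to 1 / (k + 1) dominates e^2, because e <= y and y <= 2
     z. This fixes the factor 2 in the last term of [urnB]. *)
  have c0 : 0 <= 2 * (1 + e) ^+ 2 * y - e ^+ 2 - 2 * (1 + 2 * e) * z.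
    have -> : 2 * (1 + e) ^+ 2 * y - e ^+ 2 - 2 * (1 + 2 * e) * z =
      2 * (y - z) * (1 + 2 * e) + 2 * e ^+ 2 * y - e ^+ 2 by ring.
    rewrite yz.
    have h2 : e ^+ 2 <= 2 * (y * z) by nra.
    have h3 : 0 <= y * z * e by rewrite !mulr_ge0// ltW.
    have h4 : 0 <= e ^+ 2 * y by rewrite mulr_ge0 ?exprn_ge0// ltW.
    lra.
  rewrite -subr_ge0 [X in 0 <= X](_ : _ = (T ^+ 2 * x) * (x + 1) *
      (2 * (1 + e) ^+ 2 * y - e ^+ 2 - 2 * (1 + 2 * e) * z)); last by ring.
  by apply: mulr_ge0 => //; apply: mulr_ge0 => //; exact: addr_ge0.
rewrite [X in X <= _](_ : _ = 8 * (e * x * T ^+ 3 + T ^+ 3 * x * (1 + e) +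
  (e * x * T ^+ 4 + T ^+ 4 * x * (1 + e)) +
  (e * x * T ^+ 2 * (e * x + e) +
    2 * T ^+ 2 * (x * (x + 1) * (1 + 2 * e)) * z))); last by ring.
by rewrite ler_pM2l// !lerD.
Qed.

End urn_kernel.

(** * The urn history and its Markov property *)

(* [urn_hist U B n t] lists X_(n+1), ..., X_1 ; the draw out of range
   [U n t = 0] or [U n t > n], a null event, is resolved arbitrarily. *)
Fixpoint urn_hist {T : Type} (U : nat -> T -> nat) (B : nat -> T -> bool)
    (n : nat) (t : T) : seq bool :=
  if n is m.+1 then
    (B n t && nth false (urn_hist U B m t) (n - U n t)) :: urn_hist U B m t
  else [:: true].

Definition ones (s : seq bool) : nat := count id s.

Lemma ones_sum (R : realType) (s : seq bool) :
  (ones s)%:R = \sum_(0 <= i < size s) (nth false s i)%:R :> R.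
Proof.
elim: s => [|x s IH]; first by rewrite big_geq.
by rewrite /= big_nat_recl//= natrD IH; case: x.
Qed.

Section urn_history.
Context {T : Type} (U : nat -> T -> nat) (B : nat -> T -> bool).

Lemma size_urn_hist n t : size (urn_hist U B n t) = n.+1.
Proof. by elim: n => //= n ->. Qed.

Lemma drop_urn_hist n m t : drop m (urn_hist U B (n + m) t) = urn_hist U B n t.
Proof. by elim: m => [|m IH]; rewrite ?addn0 ?drop0// addnS. Qed.

Lemma ones_urn_hist_le n t : (ones (urn_hist U B n t) <= n.+1)%N.
Proof. by rewrite -(size_urn_hist n t); exact: count_size. Qed.

Lemma ones_urn_hist_gt0 n t : (0 < ones (urn_hist U B n t))%N.
Proof. by elim: n => //= n IH; rewrite /ones/= ltn_addl. Qed.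

Lemma ones_urn_hist_homo t : {homo (fun n => ones (urn_hist U B n t)) : m n /
  (m <= n)%N}.
Proof.
apply: homo_leq => // [|n]; first exact: leq_trans.
exact: leq_addl.
Qed.

Lemma urn_histE (R : realType) (X : nat -> T -> R) n t :
  X 1%N t = 1 ->
  (forall m, (0 < m)%N -> X m.+1 t = if B m t then X (U m t) t else 0) ->
  (forall m, (0 < m)%N -> (1 <= U m t <= m)%N) ->
  forall j, (j <= n)%N -> X j.+1 t = (nth false (urn_hist U B n t) (n - j))%:R.
Proof.
move=> X1 XS UP; elim: n => [|n IH] j.
  by rewrite leqn0 => /eqP->; rewrite X1.
rewrite leq_eqVlt => /predU1P[->|jn]; last by rewrite subSn//= IH.
rewrite XS// subnn /=; case: (B _ _) => //=.
case: (U n.+1 t) (UP n.+1 (ltn0Sn n)) => // u /andP[_ un].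
Qed.

Lemma sum_urn_hist (R : realType) (X : nat -> T -> R) n t :
  X 1%N t = 1 ->
  (forall m, (0 < m)%N -> X m.+1 t = if B m t then X (U m t) t else 0) ->
  (forall m, (0 < m)%N -> (1 <= U m t <= m)%N) ->
  \sum_(1 <= i < n.+2) X i t = (ones (urn_hist U B n t))%:R.
Proof.
move=> X1 XS UP; rewrite ones_sum size_urn_hist big_add1 big_nat_rev/=.
apply: eq_big_nat => i /andP[_ ni].
rewrite add0n (urn_histE X1 XS UP (n := n)) ?leq_subr ?subKn//.
by rewrite subSS leq_subr.
Qed.

End urn_history.

Section urn_markov.
Context {d} {T : measurableType d} {R : realType} (P : probability T R).
Context (U : nat -> T -> nat) (B : nat -> T -> bool) (p : R).
Hypothesis mU : forall n k, measurable [set t | U n t = k].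
Hypothesis mB : forall n b, measurable [set t | B n t = b].
Hypothesis PU : forall n k, (1 <= k <= n)%N -> P [set t | U n t = k] = (n%:R^-1)%:E.
Hypothesis PB : forall n, (0 < n)%N -> P [set t | B n t = true] = p%:E.
Hypothesis iUB : indep_UB P U B.

Local Notation hist := (urn_hist U B).

Lemma measurable_urn_hist_set n (A : set (seq bool)) :
  measurable [set t | A (hist n t)].
Proof.
elim: n A => [|n IH] A /=.
  have [A1|A1] := pselect (A [:: true]).
    by rewrite (_ : mkset _ = setT)//; apply/seteqP; split.
  by rewrite (_ : mkset _ = set0)//; apply/seteqP; split.
rewrite (_ : mkset _ = \bigcup_k \bigcup_(b in [set: bool])
  ([set t | U n.+1 t = k] `&` [set t | B n.+1 t = b] `&`
   [set t | A ((b && nth false (hist n t) (n.+1 - k)) :: hist n t)])).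
  apply: bigcup_measurable => k _; apply: fin_bigcup_measurable => // b _.
  apply: measurableI; first exact: measurableI.
  exact: (IH (fun s => A ((b && nth false s (n.+1 - k)) :: s))).
apply/seteqP; split => [t /= At|t [k _ [b _ [[/= <- <-]]]]//].
by exists (U n.+1 t) => //; exists (B n.+1 t).
Qed.

(** A history of given length takes finitely many values, so every [g] is allowed. *)
Lemma bmeas_urn_hist n (g : seq bool -> R) : bmeas (fun t => g (hist n t)).
Proof.
split.
  by move=> _ Y _; rewrite setTI; exact: (measurable_urn_hist_set n (g @^-1` Y)).
elim: n g => [|n IH] g /=; first by exists `|g [:: true]|.
have [M gM] := IH (fun s => g (true :: s)); have [N gN] := IH (fun s => g (false :: s)).
exists (Num.max M N) => t; rewrite le_max.
by case: (_ && _); rewrite ?gM ?gN// orbT.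
Qed.

Let ev (I J : seq nat) (u : nat -> nat) (b : nat -> bool) : set T :=
  [set t | (forall n, n \in I -> U n t = u n) /\ (forall n, n \in J -> B n t = b n)].

Let measurable_ev I J u b : measurable (ev I J u b).
Proof.
rewrite (_ : ev I J u b = \bigcap_(n in [set` I]) [set t | U n t = u n] `&`
   \bigcap_(n in [set` J]) [set t | B n t = b n]).
  by apply: measurableI; apply: fin_bigcap_measurable.
by apply/seteqP; split => t [h1 h2]; split => n; [exact: h1|exact: h2|exact: h1|exact: h2].
Qed.

Let fine_P (A : set T) : measurable A -> (fine (P A))%:E = P A.
Proof. by move=> mA; rewrite fineK// fin_num_measure. Qed.

Lemma measurable_draw_range n : measurable [set t | ~ (1 <= U n t <= n)%N].
Proof.
rewrite (_ : mkset _ = \bigcup_(k in [set k | ~ (1 <= k <= n)%N]) [set t | U n t = k]).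
  by apply: bigcup_measurable => k _.
by apply/seteqP; split => [t /= h|t [k /= h ->]//]; exists (U n t).
Qed.

Lemma draw_null n : (0 < n)%N -> P [set t | ~ (1 <= U n t <= n)%N] = 0%E.
Proof.
move=> n0; have mD := measurable_draw_range n; rewrite -fine_P// -Ex_indic//; congr EFin.
have e : \1_[set t | ~ (1 <= U n t <= n)%N] =
    (fun t => 1 - \sum_(1 <= k < n.+1) \1_[set s | U n s = k] t) :> (T -> R).
  apply/funext => t; rewrite indicE.
  have [h|h] := pselect (1 <= U n t <= n)%N; last first.
    rewrite mem_set//= big_nat big1 ?subr0// => k kn.
    by rewrite indicE memNset//= => e; apply: h; rewrite e -ltnS.
  rewrite memNset//= (bigD1_seq (U n t)) ?iota_uniq ?mem_index_iota//=.
  rewrite indicE mem_set//= big1 ?addr0 ?subrr// => k /eqP kU.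
  by rewrite indicE memNset//= => e; apply: kU.
have b k : bmeas (\1_[set s | U n s = k] : T -> R) by exact: bmeas_indic.
rewrite e ExB; [|exact: bmeas_cst|exact: bmeas_sum].
rewrite Ex_cst Ex_sum// big_nat.
rewrite (eq_bigr (fun=> n%:R^-1)); last first.
  by move=> k kn; rewrite Ex_indic// PU.
rewrite -big_nat big_const_nat subn1 /= iter_addr addr0 -[_ *+ n]mulr_natl.
rewrite mulfV ?subrr//.
by rewrite pnatr_eq0 -lt0n.
Qed.

Let upd {A} (f : nat -> A) m (x : A) := fun i => if i == m then x else f i.

Let indic_ev_cons (I J : seq nat) u b m k t :
  all (fun i => m < i)%N I -> all (fun i => m < i)%N J ->
  \1_(ev (m :: I) (m :: J) (upd u m k) (upd b m true)) t =
  ((U m t == k) && B m t)%:R * \1_(ev I J u b) t :> R.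
Proof.
move=> aI aJ; rewrite !indicE -natrM mulnb; congr (_%:R); congr nat_of_bool.
have ne (L : seq nat) i : all (fun i => m < i)%N L -> i \in L -> (i == m) = false.
  by move=> /allP aL /aL mi; rewrite gtn_eqF.
apply/idP/idP.
  rewrite inE => -[h1 h2].
  have -> : U m t = k by rewrite (h1 m) ?inE ?eqxx// /upd eqxx.
  have -> : B m t = true by rewrite (h2 m) ?inE ?eqxx// /upd eqxx.
  rewrite eqxx andbT /=; apply/mem_set; split => i iI.
    by rewrite h1 ?inE ?iI ?orbT// /upd (ne _ _ aI iI).
  by rewrite h2 ?inE ?iI ?orbT// /upd (ne _ _ aJ iI).
case/andP => /andP[/eqP Uk Bm]; rewrite inE => -[h1 h2]; apply/mem_set.
split=> i; rewrite inE /upd => /predU1P[->|iI]; rewrite ?eqxx//.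
  by rewrite (ne _ _ aI iI) h1.
by rewrite (ne _ _ aJ iI) h2.
Qed.

Let P_ev_cons (I J : seq nat) u b m k :
  uniq I -> uniq J -> all (fun i => m < i)%N I -> all (fun i => m < i)%N J ->
  (1 <= k <= m)%N ->
  P (ev (m :: I) (m :: J) (upd u m k) (upd b m true)) =
  ((m%:R^-1 * p)%:E * P (ev I J u b))%E.
Proof.
move=> uI uJ aI aJ km.
have m0 : (0 < m)%N by case/andP: km => k1; exact: leq_trans.
have notin (L : seq nat) : all (fun i => m < i)%N L -> m \notin L.
  by move=> /allP aL; apply/negP => /aL; rewrite ltnn.
have pos (L : seq nat) : all (fun i => m < i)%N L -> all (fun i => 0 < i)%N L.
  by apply: sub_all => i; exact: ltn_trans.
rewrite (iUB (I := m :: I) (J := m :: J))/= ?notin ?m0 ?pos//.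
rewrite (iUB (I := I) (J := J)) ?pos// !big_cons.
have -> : (\prod_(n <- I) P [set t | U n t = upd u m k n] =
           \prod_(n <- I) P [set t | U n t = u n])%E.
  apply: eq_big_seq => i iI; rewrite /upd ifF//.
  by move/allP : aI => /(_ _ iI) mi; rewrite gtn_eqF.
have -> : (\prod_(n <- J) P [set t | B n t = upd b m true n] =
           \prod_(n <- J) P [set t | B n t = b n])%E.
  apply: eq_big_seq => i iI; rewrite /upd ifF//.
  by move/allP : aJ => /(_ _ iI) mi; rewrite gtn_eqF.
have -> : upd u m k m = k by rewrite /upd eqxx.
have -> : upd b m true m = true by rewrite /upd eqxx.
rewrite PU// PB// EFinM; exact: muleACA.
Qed.

(** The value of [g] with a new entry false is corrected only when the coin is true and the drawn
    entry is true. Summing over the drawn index [k] puts the new draw and coin into the event, where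
    independence can reach them; the identity may fail only on the null set of draws out of
    range. *)
Let hist_step_ev n (g : seq bool -> R) (I J : seq nat) u b :
  all (fun i => n.+1 < i)%N I -> all (fun i => n.+1 < i)%N J ->
  Ex P (fun t => g (hist n.+1 t) * \1_(ev I J u b) t) =
  Ex P (fun t => g (false :: hist n t) * \1_(ev I J u b) t) +
  \sum_(1 <= k < n.+2) Ex P (fun t =>
    (nth false (hist n t) (n.+1 - k))%:R * (g (true :: hist n t) - g (false :: hist n t))
    * \1_(ev (n.+1 :: I) (n.+1 :: J) (upd u n.+1 k) (upd b n.+1 true)) t).
Proof.
move=> aI aJ.
have bev I' J' u' b' : bmeas (\1_(ev I' J' u' b') : T -> R) by exact: bmeas_indic.
rewrite -Ex_sum; last first.
  move=> k; apply: bmeasM => //.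
  exact: (bmeas_urn_hist n (fun s => (nth false s (n.+1 - k))%:R *
    (g (true :: s) - g (false :: s)))).
have bS : bmeas (fun t => \sum_(1 <= k < n.+2)
    (nth false (hist n t) (n.+1 - k))%:R * (g (true :: hist n t) - g (false :: hist n t))
    * \1_(ev (n.+1 :: I) (n.+1 :: J) (upd u n.+1 k) (upd b n.+1 true)) t).
  apply: bmeas_sum => k; apply: bmeasM => //.
  exact: (bmeas_urn_hist n (fun s => (nth false s (n.+1 - k))%:R *
    (g (true :: s) - g (false :: s)))).
have b0 : bmeas (fun t => g (false :: hist n t) * \1_(ev I J u b) t).
  by apply: bmeasM => //; exact: (bmeas_urn_hist n (fun s => g (false :: s))).
rewrite -ExD//.
apply: (Ex_ae (N := [set t | ~ (1 <= U n.+1 t <= n.+1)%N])) => //.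
- by apply: bmeasM => //; exact: (bmeas_urn_hist n.+1 g).
- exact: bmeasD.
- exact: measurable_draw_range.
- exact: draw_null.
move=> t /= /contrapT Un.
rewrite (bigD1_seq (U n.+1 t)) ?iota_uniq ?mem_index_iota//=.
rewrite big1 ?addr0 => [|k kU]; last first.
  by rewrite indic_ev_cons// eq_sym (negbTE kU) /= mul0r mulr0.
rewrite indic_ev_cons// eqxx/=.
by case: (B n.+1 t) => /=; [case: (nth _ _ _) => /=|]; ring.
Qed.

(** The events must be arbitrary in the induction: opening the last step of the history transfers
    its draw and its coin to the event, and the shorter history must be independent of the enlarged
    event. *)
Lemma indep_urn_hist n (g : seq bool -> R) (I J : seq nat) u b :
  uniq I -> uniq J -> all (fun i => n < i)%N I -> all (fun i => n < i)%N J ->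
  Ex P (fun t => g (hist n t) * \1_(ev I J u b) t) =
  Ex P (fun t => g (hist n t)) * fine (P (ev I J u b)).
Proof.
have weak m (L : seq nat) : all (fun i => m.+1 < i)%N L -> all (fun i => m < i)%N L.
  by apply: sub_all => i; exact: ltn_trans.
elim: n g I J u b => [|n IH] g I J u b uI uJ aI aJ /=.
  by rewrite ExZ ?Ex_indic ?Ex_cst//; exact: bmeas_indic.
have step (K L : seq nat) v c : uniq K -> uniq L -> all (fun i => n.+1 < i)%N K ->
    all (fun i => n.+1 < i)%N L ->
  Ex P (fun t => g (hist n.+1 t) * \1_(ev K L v c) t) =
  (Ex P (fun t => g (false :: hist n t)) + \sum_(1 <= k < n.+2)
   Ex P (fun t => (nth false (hist n t) (n.+1 - k))%:R *
     (g (true :: hist n t) - g (false :: hist n t))) * (n.+1%:R^-1 * p)) *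
  fine (P (ev K L v c)).
  move=> uK uL aK aL; rewrite hist_step_ev// mulrDl; congr (_ + _).
    by rewrite (IH (fun s => g (false :: s)))// weak.
  rewrite mulr_suml big_nat [RHS]big_nat; apply: eq_bigr => k kn.
  have notin (M : seq nat) : all (fun i => n.+1 < i)%N M -> n.+1 \notin M.
    by move=> /allP aM; apply/negP => /aM; rewrite ltnn.
  have uK' : uniq (n.+1 :: K) by rewrite /= notin.
  have uL' : uniq (n.+1 :: L) by rewrite /= notin.
  have aK' : all (fun i => n < i)%N (n.+1 :: K) by rewrite /= ltnSn weak.
  have aL' : all (fun i => n < i)%N (n.+1 :: L) by rewrite /= ltnSn weak.
  have := IH (fun s => (nth false s (n.+1 - k))%:R * (g (true :: s) - g (false :: s)))
    (n.+1 :: K) (n.+1 :: L) (upd v n.+1 k) (upd c n.+1 true) uK' uL' aK' aL'.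
  rewrite P_ev_cons// => ->; rewrite -mulrA; congr (_ * _).
  by rewrite -[in LHS]fine_P// -EFinM.
(* The factor in front of the probability does not depend on the event; the empty constraint, of
   probability one, identifies it as the mean of [g]. *)
have := step [::] [::] u b isT isT isT isT.
have -> : ev [::] [::] u b = setT by apply/seteqP; split.
under eq_fun do rewrite indicT mulr1.
rewrite probability_setT mulr1 => ->.
exact: step.
Qed.

Lemma Ex_urn_hist_step n (g : seq bool -> R) :
  Ex P (fun t => g (hist n.+1 t)) =
  Ex P (fun t => (1 - p * (ones (hist n t))%:R / n.+1%:R) * g (false :: hist n t)
              + p * (ones (hist n t))%:R / n.+1%:R * g (true :: hist n t)).
Proof.
pose c := n.+1%:R^-1 * p.
pose D k t : R := (nth false (hist n t) (n.+1 - k))%:R *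
  (g (true :: hist n t) - g (false :: hist n t)).
have bD k : bmeas (D k).
  exact: (bmeas_urn_hist n (fun s => (nth false s (n.+1 - k))%:R *
    (g (true :: s) - g (false :: s)))).
have b0 : bmeas (fun t => g (false :: hist n t)).
  exact: (bmeas_urn_hist n (fun s => g (false :: s))).
pose u := fun _ : nat => 0%N; pose b := fun _ : nat => false.
have ev0 : ev [::] [::] u b = setT by apply/seteqP; split.
have := @hist_step_ev n g [::] [::] u b isT isT.
rewrite ev0; under eq_fun do rewrite indicT mulr1; move=> ->.
under eq_fun do rewrite indicT mulr1.
have -> : \sum_(1 <= k < n.+2) Ex P (fun t => D k t * \1_(ev [:: n.+1] [:: n.+1]
    (upd u n.+1 k) (upd b n.+1 true)) t) = \sum_(1 <= k < n.+2) Ex P (fun t => c * D k t).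
  rewrite big_nat [RHS]big_nat; apply: eq_bigr => k kn.
  have := @indep_urn_hist n (fun s => (nth false s (n.+1 - k))%:R *
    (g (true :: s) - g (false :: s))) [:: n.+1] [:: n.+1] (upd u n.+1 k) (upd b n.+1 true).
  rewrite /= ltnSn => /(_ isT isT isT isT) ->.
  rewrite P_ev_cons// ev0 probability_setT mule1 ExZ//= mulrC.
  by [].
have bcD k : bmeas (fun t => c * D k t) by apply: bmeasM => //; exact: bmeas_cst.
rewrite -Ex_sum// -ExD//; last exact: bmeas_sum.
congr (Ex P _); apply/funext => t.
rewrite -mulr_sumr -mulr_suml ones_sum size_urn_hist.
have -> : \sum_(1 <= k < n.+2) (nth false (hist n t) (n.+1 - k))%:R =
    \sum_(0 <= i < n.+1) (nth false (hist n t) i)%:R :> R.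
  by rewrite big_add1 big_nat_rev/=; apply: eq_big_nat => i ni; rewrite add0n subSS subKn.
by rewrite /c; ring.
Qed.

(** [hist m] has m + 1 entries, whence the predecessor. For n = 0 the value is 1, which keeps
    positivity valid at every index. *)
Local Notation Hn n t := (ones (hist n.-1 t)).

(** The Markov property with H_n kept as a parameter. The history at n is a suffix of the later one,
    so a function of both counts is a function of the later history alone. *)
Lemma Ex_urn_step n k (f : nat -> nat -> R) : (0 < n <= k)%N ->
  Ex P (fun t => f (Hn n t) (Hn k.+1 t)) =
  Ex P (fun t => urnK p k (f (Hn n t)) (Hn k t)).
Proof.
case: n => // n; case: k => // k nk; rewrite /=.
pose g s := f (ones (drop (k.+1 - n) s)) (ones s).
have dn m t : (n <= m)%N -> drop (m - n) (hist m t) = hist n t.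
  by move=> nm; rewrite -{2}(subnKC nm) drop_urn_hist.
transitivity (Ex P (fun t => g (hist k.+1 t))).
  by congr (Ex P _); apply/funext => t; rewrite /g dn// ltnW.
rewrite Ex_urn_hist_step; congr (Ex P _); apply/funext => t.
by rewrite /g subSn//= dn.
Qed.

Lemma Ex_urn_steps n k m (f : nat -> nat -> R) : (0 < n <= k)%N ->
  Ex P (fun t => f (Hn n t) (Hn (k + m)%N t)) =
  Ex P (fun t => urnKs p k m (f (Hn n t)) (Hn k t)).
Proof.
elim: m k f => [|m IH] k f /andP[n0 nk] /=; first by rewrite addn0.
rewrite -addSnnS IH ?n0 ?leqW//.
by rewrite (Ex_urn_step (fun h => urnKs p k.+1 m (f h))) ?n0.
Qed.

End urn_markov.

(** * The recursion satisfied by the normalizing sequence *)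

Section gamma_recursion.
Context {R : realType}.
Notation mu := (@lebesgue_measure R).

Let gi (r x : R) := x `^ r * expR (- x).

(** From y <= exp(y) at y = x / (2 r), raised to the power r. The bound is a multiple of the
    exponential density of rate 1/2 and also controls the boundary term at infinity. *)
Let gi_le (r x : R) : 0 <= r -> 0 < x ->
  gi r x <= (2 * r) `^ r * expR (- (x / 2)).
Proof.
rewrite le_eqVlt => /predU1P[<-|r0] x0; rewrite /gi.
  by rewrite !powRr0 !mul1r ler_expR; lra.
have -> : x `^ r = (2 * r) `^ r * (x / (2 * r)) `^ r.
  rewrite -powRM ?divr_ge0 ?mulr_ge0 ?(ltW r0) ?(ltW x0)//.
  by rewrite mulrC mulfVK// mulf_neq0 ?gt_eqF.
rewrite -mulrA ler_wpM2l ?powR_ge0//.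
have -> : - (x / 2) = x / 2 + - x by field.
rewrite expRD ler_wpM2r ?expR_ge0//.
have -> : x / 2 = x / (2 * r) * r by field; rewrite gt_eqF.
rewrite expRM ge0_ler_powR ?(ltW r0)// ?nnegrE ?expR_ge0//.
  by rewrite divr_ge0 ?mulr_ge0 ?(ltW r0) ?(ltW x0).
by have := expR_ge1Dx (x / (2 * r)); lra.
Qed.

Let pos := `]0%R, +oo[%classic : set R.

Let pos_gt0 x : pos x -> 0 < x.
Proof. by rewrite /pos/= in_itv/= andbT. Qed.

Let measurable_pos : measurable pos.
Proof. exact: measurable_itv. Qed.

Let measurable_gi r : measurable_fun setT (gi r).
Proof.
apply: measurable_funM; first exact: measurable_powR.
by apply: measurableT_comp => //; exact: measurableT_comp.
Qed.

Let integrable_gi (r : R) : 0 <= r -> mu.-integrable pos (EFin \o gi r).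
Proof.
move=> r0.
have i0 : mu.-integrable pos (EFin \o exponential_pdf (2^-1 : R)).
  apply: (@integrableS _ _ _ mu setT) => //.
  apply/integrableP; split.
    by apply/measurable_EFinP; exact: measurable_exponential_pdf.
  under eq_integral do rewrite /= ger0_norm ?exponential_pdf_ge0//.
  by rewrite integral_exponential_pdf ?ltry.
apply: (le_integrable _ _ _ (integrableZl _ ((2 * r) `^ r * 2) i0)) => //.
  by apply/measurable_EFinP/measurable_funTS; exact: measurable_gi.
move=> x /pos_gt0 x0; rewrite /= lee_fin.
rewrite [leLHS]ger0_norm ?mulr_ge0 ?powR_ge0 ?expR_ge0//.
apply: le_trans (ler_norm _); apply: le_trans (gi_le r0 x0) _.
rewrite exponential_pdfE ?(ltW x0)// -mulrA ler_wpM2l ?powR_ge0// mulrA mulfV ?pnatr_eq0//.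
by rewrite mul1r mulNr [2^-1 * x]mulrC.
Qed.

Let GammaE (s : R) : Gamma s = \int[mu]_(x in pos) gi (s - 1) x.
Proof. by []. Qed.

Lemma Gamma_gt0 (s : R) : 1 <= s -> 0 < Gamma s.
Proof.
move=> s1; rewrite GammaE; set r := s - 1.
have r0 : 0 <= r by rewrite subr_ge0.
have sub : `[1%R, 2%R]%classic `<=` pos.
  by move=> x; rewrite /pos/= !in_itv/= andbT => /andP[x1 _]; exact: lt_le_trans x1.
have := integrable_gi r0 => ig.
have fi : (\int[mu]_(x in pos) (gi r x)%:E)%E \is a fin_num by exact: integrable_fin_num.
rewrite -lte_fin /Rintegral fineK//.
apply: (@lt_le_trans _ _ (\int[mu]_(x in `[1%R, 2%R]) (expR (- 2))%:E)%E).
  rewrite integral_cst//= lebesgue_measure_itv/= lte_fin ltr1n/=.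
  by rewrite -EFinB -EFinM lte_fin mulr_gt0 ?expR_gt0//; lra.
apply: (@le_trans _ _ (\int[mu]_(x in `[1%R, 2%R]) (gi r x)%:E)%E).
  apply: ge0_le_integral => //.
  - by apply/measurable_EFinP/measurable_funTS; exact: measurable_gi.
  - move=> x; rewrite /= in_itv/= => /andP[x1 x2].
    rewrite lee_fin /gi -[leLHS]mul1r ler_pM ?expR_ge0 ?ler_expR ?lerN2//.
    by rewrite -(powRr0 x) ler_powR.
apply: ge0_subset_integral => //.
  by apply/measurable_EFinP/measurable_funTS; exact: measurable_gi.
by move=> x _; rewrite lee_fin mulr_ge0 ?powR_ge0 ?expR_ge0.
Qed.

Let g (s x : R) := gi s x - s * gi (s - 1) x.

Let is_derive_gi (s x : R) : 0 < x -> is_derive x 1 (fun x => - gi s x) (g s x).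
Proof.
move=> x0; have dp := is_derive1_powR s x0.
have de : is_derive x 1 (fun x => expR (- x)) (- expR (- x)).
  by apply: is_derive_eq; rewrite /GRing.scale/=; ring.
rewrite /g /gi; apply: is_derive_eq; rewrite /GRing.scale/=; ring.
Qed.

Let continuous_gi (r x : R) : 0 < x -> {for x, continuous (gi r)}.
Proof.
move=> x0; apply: cvgM.
  have xi : x \in `]0, +oo[ by rewrite in_itv/= x0.
  by have /derivable1_diffP/differentiable_continuous := @derivable_powR R 1 r x xi.
apply: (cvg_comp _ expR); last exact: continuous_expR.
by apply: cvgN; exact: cvg_id.
Qed.

Let integrable_g (s : R) : 1 <= s -> mu.-integrable pos (EFin \o g s).
Proof.
move=> s1; have i1 : mu.-integrable pos (EFin \o gi s) by apply: integrable_gi; lra.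
have i2 : mu.-integrable pos (EFin \o gi (s - 1)) by apply: integrable_gi; lra.
exact: (integrableB _ i1 (integrableZl _ s i2)).
Qed.

Let integral_g (s : R) : 1 <= s -> \int[mu]_(x in pos) g s x = 0.
Proof.
move=> s1.
(* With [n.+2] the end points are distinct already at n = 0, and the interval stays inside x > 0,
   where [gi s] is differentiable. *)
pose I (n : nat) : set R := `[n.+2%:R^-1, n.+2%:R]%classic.
have n0 (n : nat) : 0 < n.+2%:R^-1 :> R by rewrite invr_gt0.
have Ipos n x : I n x -> 0 < x.
  by rewrite /I/= in_itv/= => /andP[h _]; exact: lt_le_trans h.
have mI n : measurable (I n) by exact: measurable_itv.
have ftc n : (\int[mu]_(x in I n) (g s x)%:E =
    (- gi s n.+2%:R)%:E - (- gi s n.+2%:R^-1)%:E)%E.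
  apply: (@continuous_FTC2 _ _ (fun x => - gi s x)).
  - by rewrite (@lt_trans _ _ 1)// ?invf_lt1// ltr1n.
  - apply/continuous_in_subspaceT => x; rewrite inE => /Ipos x0.
    apply: cvgB; first exact: continuous_gi.
    by apply: cvgM; [exact: cvg_cst|exact: continuous_gi].
  - split=> [x||].
    + rewrite in_itv/= => /andP[x0 _].
      by have [] := is_derive_gi s (lt_trans (n0 n) x0).
    + by apply: cvg_at_right_filter; apply: cvgN; exact: continuous_gi.
    + by apply: cvg_at_left_filter; apply: cvgN; exact: continuous_gi.
  - move=> x; rewrite in_itv/= => /andP[x0 _].
    by rewrite derive1E; have [_ ->] := is_derive_gi s (lt_trans (n0 n) x0).
have mg : measurable_fun pos (fun x => (g s x)%:E).
  exact: (measurable_int mu (integrable_g s1)).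
have Isub n : I n `<=` pos by move=> x /Ipos x0; rewrite /pos/= in_itv/= x0.
have dct : (\int[mu]_(x in I n) (g s x)%:E)%E @[n --> \oo]
    --> (\int[mu]_(x in pos) (g s x)%:E)%E.
  have -> : (fun n => \int[mu]_(x in I n) (g s x)%:E)%E =
      (fun n => \int[mu]_(x in pos) ((fun x => (g s x)%:E) \_ (I n)) x)%E.
    by apply/funext => n; rewrite -integral_mkcondr setIidr.
  have mg_ n : measurable_fun pos ((fun x => (g s x)%:E) \_ (I n)).
    apply/(measurable_restrict _ _ _).1 => //.
    by apply: measurable_funS mg => // x [].
  have cg : {ae mu, forall x, pos x ->
      ((fun x => (g s x)%:E) \_ (I n)) x @[n --> \oo] --> (g s x)%:E}.
    apply: aeW => x /pos_gt0 x0; apply: cvg_near_cst.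
    near=> n; rewrite patchE mem_set// /I/= in_itv/=; apply/andP; split.
      rewrite -[leRHS]invrK lef_pV2 ?posrE ?invr_gt0//.
      apply: (@le_trans _ _ n%:R); last by rewrite ler_nat -addn2 leq_addr.
      by near: n; exact: nbhs_infty_ger.
    apply: (@le_trans _ _ n%:R); last by rewrite ler_nat -addn2 leq_addr.
    by near: n; exact: nbhs_infty_ger.
  have dg : {ae mu, forall x n, pos x ->
      (`|((fun x => (g s x)%:E) \_ (I n)) x| <= `|(g s x)%:E|)%E}.
    apply: aeW => x n _; rewrite patchE; case: ifP => _ //.
    by rewrite abse0 abse_ge0.
  by have [] := @dominated_convergence _ _ R mu pos measurable_pos _ _ _ mg_ mg cg
    (integrable_abse (integrable_g s1)) dg.
have lim0 : ((- gi s n.+2%:R)%:E - (- gi s n.+2%:R^-1)%:E)%E @[n --> \oo]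
    --> (0 : \bar R).
  under eq_fun do rewrite -EFinB.
  apply: cvg_EFin; first exact: nearW.
  pose C := 2 * (2 * s) `^ s + 1.
  have s0 : 0 <= s by lra.
  apply/cvgr0Pnorm_le => e e0; near=> n.
  have C0 : 0 <= (2 * s) `^ s by exact: powR_ge0.
  have h1 : gi s n.+2%:R <= 2 * (2 * s) `^ s / n.+2%:R.
    apply: le_trans (gi_le s0 (ltr0Sn _ _)) _.
    rewrite -mulrA mulrCA ler_wpM2l//.
    have := expR_ge1Dx (n.+2%:R / 2 : R) => h.
    by rewrite ler_pdivlMr// expRN ler_pdivrMl ?expR_gt0//; lra.
  have h2 : gi s n.+2%:R^-1 <= 1 / n.+2%:R.
    rewrite div1r /gi -[leRHS]mulr1 ler_pM ?powR_ge0 ?expR_ge0//.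
      by apply: ge1r_powR => //; rewrite n0 invf_le1// ler1n.
  have gi0 x : 0 <= gi s x by rewrite mulr_ge0 ?powR_ge0 ?expR_ge0.
  have : `|- gi s n.+2%:R - - gi s n.+2%:R^-1| <= C / n.+2%:R.
    rewrite opprK /C mulrDl; apply: le_trans (ler_normD _ _) _.
    by rewrite normrN !ger0_norm// lerD.
  move/le_trans; apply.
  rewrite ler_pdivrMr// -ler_pdivrMl//.
  apply: (@le_trans _ _ n%:R); last by rewrite ler_nat -addn2 leq_addr.
  by near: n; exact: nbhs_infty_ger.
move: dct; rewrite (funext ftc) => dct.
rewrite /Rintegral -(cvg_lim (@ereal_hausdorff R) dct).
by rewrite (cvg_lim (@ereal_hausdorff R) lim0).
Unshelve. all: by end_near. Qed.

Lemma GammaS (s : R) : 1 <= s -> Gamma (s + 1) = s * Gamma s.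
Proof.
move=> s1; have := integral_g s1; rewrite /g.
have i1 : mu.-integrable pos (EFin \o gi s) by apply: integrable_gi; lra.
have i2 : mu.-integrable pos (EFin \o gi (s - 1)) by apply: integrable_gi; lra.
rewrite RintegralB//; last exact: (integrableZl _ s i2).
rewrite RintegralZl// !GammaE addrK => /eqP; rewrite subr_eq0 => /eqP.
exact.
Qed.

Variable p : R.
Hypothesis p01 : 0 < p < 1.

Lemma a_seq_gt0 n : (0 < n)%N -> 0 < a_seq p n.
Proof.
move=> n0; case/andP: p01 => p0 p1; have n1 : 1 <= n%:R :> R by rewrite ler1n.
by rewrite /a_seq divr_gt0 ?mulr_gt0// Gamma_gt0//; lra.
Qed.

Lemma a_seqS n : (0 < n)%N -> a_seq p n.+1 = a_seq p n * (1 + p / n%:R).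
Proof.
move=> n0; case/andP: p01 => p0 p1; have n1 : 1 <= n%:R :> R by rewrite ler1n.
rewrite /a_seq -natr1 addrAC !GammaS//; last by lra.
have G1 : Gamma (n%:R : R) != 0 by rewrite gt_eqF// Gamma_gt0.
have G2 : Gamma (1 + p) != 0 by rewrite gt_eqF// Gamma_gt0//; lra.
by field; rewrite G1 G2 /= pnatr_eq0 -lt0n n0.
Qed.

End gamma_recursion.

(** * Limit theorems for the urn chain *)

Section urn_limit.
Context {d} {T : measurableType d} {R : realType} (P : probability T R).
Variables (p : R) (a : nat -> R) (h : nat -> T -> nat) (What Wcal : T -> R).
Variable N : set T.
Hypothesis p01 : 0 < p < 1.
Hypothesis a_gt0 : forall k, (0 < k)%N -> 0 < a k.
Hypothesis aS : forall k, (0 < k)%N -> a k.+1 = a k * (1 + p / k%:R).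
Hypothesis h_gt0 : forall n t, (0 < h n t)%N.
Hypothesis h_le : forall n t, (0 < n)%N -> (h n t <= n)%N.
Hypothesis h_homo : forall t, {homo h^~ t : m n / (m <= n)%N}.
Hypothesis bh : forall n (g : nat -> R), bmeas (fun t => g (h n t)).
Hypothesis h_markov : forall n k m (f : nat -> nat -> R), (0 < n <= k)%N ->
  Ex P (fun t => f (h n t) (h (k + m)%N t)) =
  Ex P (fun t => urnKs p k m (f (h n t)) (h k t)).
Hypothesis mWhat : measurable_fun setT What.
Hypothesis mWcal : measurable_fun setT Wcal.
Hypothesis mN : measurable N.
Hypothesis PN : P N = 0%E.
Hypothesis cWhat : forall t, ~ N t -> (h n t)%:R / a n @[n --> \oo] --> What t.
Hypothesis cWcal : forall t, ~ N t ->
  (h n t)%:R / n%:R `^ p @[n --> \oo] --> Wcal t.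

Let p0 : 0 < p. Proof. by case/andP: p01. Qed.
Let p1 : p < 1. Proof. by case/andP: p01. Qed.

(** The increments a_k p / k are at least a_1 p / k, so [a] grows at least like the harmonic
    series. *)
Lemma a_cvgy : a n @[n --> \oo] --> +oo.
Proof.
have a1 : 0 < a 1 by exact: a_gt0.
have homo n : (0 < n)%N -> a 1 <= a n.
  elim: n => // -[|n] IH _ //; apply: le_trans (IH isT) _.
  rewrite (aS (ltn0Sn n)) ler_peMr ?ltW ?a_gt0// ltrDl; exact: divr_gt0.
have lb n : a 1 * (p * series (@harmonic R) n) <= a n.+1.
  elim: n => [|n IH].
    by rewrite /series/= big_geq// !mulr0 ltW.
  rewrite (aS (ltn0Sn n)) mulrDr mulr1 /series/= big_nat_recr//= !mulrDr.
  apply: lerD; first exact: IH.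
  by rewrite ler_pM ?homo// ltW// ?mulr_gt0// invr_gt0.
have : series (@harmonic R) @ \oo --> +oo.
  apply: nondecreasing_dvgn_lt; last exact: dvg_harmonic.
  by apply: nondecreasing_series => n _ _; rewrite invr_ge0.
move/cvgryPge => dv; rewrite -(cvg_shiftS (fun n => a n)).
apply/cvgryPge => A; have := dv (A / (a 1 * p)).
apply: filterS => n; rewrite ler_pdivrMr ?mulr_gt0// => hA.
by apply: le_trans (lb n); rewrite mulrA mulrC.
Qed.

Lemma a_inv_cvg0 : (a n)^-1 @[n --> \oo] --> 0.
Proof.
apply/gtr0_cvgV0; last exact: a_cvgy.
by exists 1%N => // n /= n1; exact: a_gt0.
Qed.

(** [bh] covers functions of a single count; splitting over the finitely many values of [h n]
    reduces to it. *)
Lemma bmeas_pair n m (f : nat -> nat -> R) : (0 < n)%N ->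
  bmeas (fun t => f (h n t) (h m t)).
Proof.
move=> n0.
have -> : (fun t => f (h n t) (h m t)) =
    (fun t => \sum_(0 <= i < n.+1) (h n t == i)%:R * f i (h m t)).
  apply/funext => t; rewrite (bigD1_seq (h n t)) ?iota_uniq//=; last first.
    by rewrite mem_index_iota ltnS h_le.
  rewrite eqxx mul1r big1 ?addr0// => i /negbTE.
  by rewrite eq_sym => ->; rewrite mul0r.
by apply: bmeas_sum => i; apply: bmeasM; [exact: (bh n (fun x => (x == i)%:R))|exact: bh].
Qed.

(** The value of [urnB] at the starting time n for b = l a_n, where a_n cancels. *)
Definition urn_error (l : R) (n : nat) (x : R) : R :=
  8 * (`|l| ^+ 3 * x + `|l| ^+ 4 * x + 2 * `|l| ^+ 2 * (x * (x + 1)) / n%:R).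

Let measurable_cos : measurable_fun setT (@cos R).
Proof. by apply: continuous_measurable_fun; exact: continuous_cos. Qed.

Let mh n (g : nat -> R) : measurable_fun setT (fun t => g (h n t)).
Proof. by case: (bh n g). Qed.

Lemma bmeas_minr (c : R) (g : T -> R) : 0 <= c -> (forall t, 0 <= g t) ->
  measurable_fun setT g -> bmeas (fun t => Num.min c (g t)).
Proof.
move=> c0 g0 mg; split; first by apply: measurable_minr.
by exists c => t; rewrite ger0_norm ?ge_min ?lexx// le_min c0 g0.
Qed.

(** The scale [l] may be a function of [h n t] since that count is a parameter of the iterated
    operator. The minimum with 2, the trivial bound, later allows bounded convergence. *)
Lemma clt_bound n (l : nat -> R) al : (0 < n)%N ->
  `|Ex P (fun t => cos (al + l (h n t) * (h n t)%:R - l (h n t) * a n * What t))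
    - Ex P (fun t => expR (- (l (h n t) ^+ 2 * (h n t)%:R / 2)) * cos al)|
  <= Ex P (fun t => Num.min 2 (urn_error (l (h n t)) n (h n t)%:R)).
Proof.
move=> n0; have an := a_gt0 n0.
pose f m x y := urnF a (l x * a n) (al + l x * x%:R) (n + m) y.
pose g x := expR (- (l x ^+ 2 * x%:R / 2)) * cos al.
pose e x := Num.min 2 (urn_error (l x) n x%:R).
have le1 (x z : R) (y : nat) : `|expR (- (x ^+ 2 * y%:R / 2)) * cos z| <= 1.
  rewrite normrM; apply: mulr_ile1 => //; last exact: cos_max.
  rewrite ger0_norm ?expR_ge0// -[leRHS]expR0 ler_expR oppr_le0 divr_ge0//.
  by rewrite mulr_ge0// sqr_ge0.
have bf m : bmeas (fun t => f m (h n t) (h (n + m)%N t)) by exact: bmeas_pair.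
have bg : bmeas (fun t => g (h n t)) by exact: bh.
have be : bmeas (fun t => e (h n t)) by exact: bh.
have step m : `|Ex P (fun t => f m (h n t) (h (n + m)%N t)) - Ex P (fun t => g (h n t))|
    <= Ex P (fun t => e (h n t)).
  rewrite h_markov ?n0 ?leqnn//.
  have bK : bmeas (fun t => urnKs p n m (f m (h n t)) (h n t)).
    exact: (bh n (fun x => urnKs p n m (f m x) x)).
  rewrite -ExB//; apply: le_trans (Ex_norm P (bmeasB bK bg)) _.
  apply: le_Ex => // [|t]; first exact/bmeas_norm/bmeasB.
  have ht := h_le t n0; set x := h n t in ht *.
  have gE : g x = urnF a (l x * a n) (al + l x * x%:R) n x.
    by rewrite /g /urnF mulfK ?gt_eqF// addrK.
  rewrite /e le_min; apply/andP; split.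
    apply: le_trans (ler_normB _ _) _.
    have : `|urnKs p n m (f m x) x| <= 1.
      by apply: (norm_urnKs p01) => // y; exact: le1.
    by have := le1 (l x) al x; rewrite -/(g x); lra.
  have -> : urn_error (l x) n x%:R = urnB a (l x * a n) n x.
    by rewrite /urn_error /urnB normrM (gtr0_norm an) mulfK ?gt_eqF.
  rewrite gE; apply: (@urnKs_approx R p p01 (urnF a (l x * a n) (al + l x * x%:R))
    (urnB a (l x * a n)) n m x) => // k y k0.
    by move=> _; exact: urnB_ge0.
  by move=> yk; exact: (urnB_step p01 a_gt0 aS).
(* The bound just obtained is uniform in [m]. As m grows, b^2 H / a^2 = b^2 (1 / a) (H / a) tends to
   0, so the Gaussian factor disappears and H / a becomes [What] in the phase. *)
have cf : Ex P (fun t => f m (h n t) (h (n + m)%N t)) @[m --> \oo] -->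
    Ex P (fun t => cos (al + l (h n t) * (h n t)%:R - l (h n t) * a n * What t)).
  apply: (@Ex_cvg _ _ _ P _ _ 1 N) => //.
  - by move=> m; case: (bf m).
  - apply: measurableT_comp => //; apply: measurable_funB.
      exact: (mh n (fun x => al + l x * x%:R)).
    by apply: measurable_funM => //; exact: (mh n (fun x => l x * a n)).
  - by move=> m t; exact: le1.
  move=> t Nt; set x := h n t; set b := l x * a n.
  have c1 : (h (n + m)%N t)%:R / a (n + m)%N @[m --> \oo] --> What t.
    have := cWhat Nt; rewrite -(cvg_shiftn n (fun m => (h m t)%:R / a m)).
    by under eq_fun do rewrite addnC.
  have c0 : (a (n + m)%N)^-1 @[m --> \oo] --> 0.
    have := a_inv_cvg0; rewrite -(cvg_shiftn n (fun m => (a m)^-1)).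
    by under eq_fun do rewrite addnC.
  have cc : cos (al + l x * x%:R - b * ((h (n + m)%N t)%:R / a (n + m)%N))
      @[m --> \oo] --> cos (al + l x * x%:R - b * What t).
    apply: continuous_cvg; first exact: continuous_cos.
    by apply: cvgB; [exact: cvg_cst|apply: cvgM => //; exact: cvg_cst].
  have ce : expR (- (b ^+ 2 * (a (n + m)%N)^-1 * ((h (n + m)%N t)%:R / a (n + m)%N) / 2))
      @[m --> \oo] --> expR (- (b ^+ 2 * 0 * What t / 2)).
    apply: continuous_cvg; first exact: continuous_expR.
    apply: cvgN; apply: cvgM; last exact: cvg_cst.
    by apply: cvgM => //; apply: cvgM => //; exact: cvg_cst.
  have fE m : f m x (h (n + m)%N t) =
      expR (- (b ^+ 2 * (a (n + m)%N)^-1 * ((h (n + m)%N t)%:R / a (n + m)%N) / 2)) *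
      cos (al + l x * x%:R - b * ((h (n + m)%N t)%:R / a (n + m)%N)).
    by rewrite /f /urnF /b; congr (expR _ * cos _); ring.
  rewrite (funext fE); have := cvgM ce cc.
  by rewrite mulr0 mul0r mul0r oppr0 expR0 mul1r => cM; exact: cM.
apply: (cvgr_to_le (cvg_norm (cvgB cf (cvg_cst (Ex P (fun t => g (h n t))))))).
by apply: nearW => m; exact: step.
Qed.

Lemma urn_error_ge0 l n x : 0 <= x -> 0 <= urn_error l n x.
Proof.
move=> x0; rewrite /urn_error.
have wn k : 0 <= `|l| ^+ k * x by rewrite mulr_ge0// exprn_ge0.
apply: mulr_ge0 => //; apply: addr_ge0; first exact: addr_ge0.
apply: divr_ge0 => //; apply: mulr_ge0; last by apply: mulr_ge0 => //; exact: addr_ge0.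
by apply: mulr_ge0 => //; exact: exprn_ge0.
Qed.

(** Used with l = th / sqrt(n^p), where the limit variance is th^2 Wcal, and with l = th /
    sqrt(H_n), where it is the constant th^2. *)
Lemma clt_limit (l : nat -> nat -> R) (V : T -> R) (M : set T) al :
  measurable_fun setT V -> measurable M -> P M = 0%E ->
  (forall t, ~ M t ->
    urn_error (l n (h n t)) n (h n t)%:R @[n --> \oo] --> 0) ->
  (forall t, ~ M t -> l n (h n t) ^+ 2 * (h n t)%:R @[n --> \oo] --> V t) ->
  Ex P (fun t => cos (al + l n (h n t) * (h n t)%:R - l n (h n t) * a n * What t))
    @[n --> \oo] --> Ex P (fun t => expR (- (V t / 2)) * cos al).
Proof.
move=> mV mM PM err0 varV.
have e0 : Ex P (fun t => Num.min 2 (urn_error (l n (h n t)) n (h n t)%:R))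
    @[n --> \oo] --> 0.
  rewrite -(Ex_cst P 0); apply: (@Ex_cvg _ _ _ P _ _ 2 M) => //.
  - by move=> n; exact: (mh n (fun x => Num.min 2 (urn_error (l n x) n x%:R))).
  - move=> n t; have := urn_error_ge0 (l n (h n t)) n (ler0n R (h n t)) => e0.
    by rewrite ger0_norm ?ge_min ?lexx// le_min e0 andbT.
  - move=> t Mt; apply: (squeeze_cvgr _ (cvg_cst 0) (err0 t Mt)).
    apply: nearW => n; have := urn_error_ge0 (l n (h n t)) n (ler0n R (h n t)) => e0.
    by rewrite le_min e0 ge_min lexx orbT !andbT.
have e1 : Ex P (fun t => expR (- (l n (h n t) ^+ 2 * (h n t)%:R / 2)) * cos al)
    @[n --> \oo] --> Ex P (fun t => expR (- (V t / 2)) * cos al).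
  apply: (@Ex_cvg _ _ _ P _ _ 1 M) => //.
  - by move=> n; exact: (mh n (fun x => expR (- (l n x ^+ 2 * x%:R / 2)) * cos al)).
  - apply: measurable_funM => //; apply: measurableT_comp => //.
    by apply: measurableT_comp => //; exact: measurable_funM.
  - move=> n t; rewrite normrM; apply: mulr_ile1 => //; last exact: cos_max.
    rewrite ger0_norm ?expR_ge0// -[leRHS]expR0 ler_expR oppr_le0 divr_ge0//.
    by rewrite mulr_ge0// sqr_ge0.
  - move=> t Mt; apply: cvgM; last exact: cvg_cst.
    apply: continuous_cvg; first exact: continuous_expR.
    by apply: cvgN; apply: cvgM; [exact: varV|exact: cvg_cst].
set A := fun n => Ex P _ in e1; set C := fun n => Ex P _.
have c0 : C n - A n @[n --> \oo] --> 0.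
  apply: norm_cvg0; apply: (squeeze_cvgr _ (cvg_cst 0) e0).
  by exists 1%N => // n /= n0; rewrite normr_ge0 clt_bound.
have -> : C = (fun n => (C n - A n) + A n) by apply/funext => n; rewrite subrK.
by rewrite -[X in _ --> X]add0r; exact: cvgD.
Qed.

Lemma natpow_inv_cvg0 (r : R) : 0 < r -> (n%:R `^ r)^-1 @[n --> \oo] --> (0 : R).
Proof.
move=> r0; apply/cvgr0Pnorm_le => e e0; near=> n.
rewrite ger0_norm ?invr_ge0 ?powR_ge0// -[leRHS]invrK lef_pV2 ?posrE ?invr_gt0//.
  have -> : e^-1 = (e^-1 `^ r^-1) `^ r.
    by rewrite -powRrM mulVf ?gt_eqF// powRr1// invr_ge0 ltW.
  rewrite ge0_ler_powR ?nnegrE ?powR_ge0 ?(ltW r0)//.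
  by near: n; exact: nbhs_infty_ger.
by apply: powR_gt0; rewrite ltr0n; near: n; exists 1%N.
Unshelve. all: by end_near. Qed.

Let w n t : R := (h n t)%:R / n%:R `^ p.
Let v n : R := n%:R `^ p / n%:R.

(** [w n t * v n] is H_n / n. It tends to 0 because p < 1, which disposes of the part of the error
    that is quadratic in H. *)
Let v_cvg0 : v n @[n --> \oo] --> 0.
Proof.
have := @natpow_inv_cvg0 (1 - p); rewrite subr_gt0 => /(_ p1).
apply: cvg_trans; apply: near_eq_cvg; exists 1%N => // n /= n1.
have n0 : n%:R != 0 :> R by rewrite pnatr_eq0 -lt0n.
rewrite /v powRB; last by rewrite n0 implybT.
by rewrite powRr1// invfM invrK mulrC.
Qed.

Let inv_cvg0 : n%:R^-1 @[n --> \oo] --> (0 : R).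
Proof.
have := natpow_inv_cvg0 (@ltr01 R).
by under eq_fun do rewrite powRr1//.
Qed.

Let sqrt_powE n : Num.sqrt (n%:R `^ p) = n%:R `^ (p / 2) :> R.
Proof. by rewrite powRrM powR12_sqrt// powR_ge0. Qed.

Let pow_gt0 n : (0 < n)%N -> 0 < n%:R `^ p :> R.
Proof. by move=> n0; rewrite powR_gt0// ltr0n. Qed.

Lemma clt_stable th al :
  Ex P (fun t => cos (th * (((h n t)%:R - What t * a n) / Num.sqrt (n%:R `^ p)) + al))
    @[n --> \oo] --> Ex P (fun t => expR (- (th ^+ 2 * Wcal t / 2)) * cos al).
Proof.
pose s n : R := Num.sqrt (n%:R `^ p).
pose l n (_ : nat) : R := th / s n.
have s0 n : (0 < n)%N -> 0 < s n by move=> n0; rewrite sqrtr_gt0 pow_gt0.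
have s2 n : s n ^+ 2 = n%:R `^ p by rewrite sqr_sqrtr// powR_ge0.
have cs : (s n)^-1 @[n --> \oo] --> 0.
  have := @natpow_inv_cvg0 (p / 2); rewrite divr_gt0// => /(_ isT).
  by under eq_fun do rewrite -sqrt_powE.
have := @clt_limit l (fun t => th ^+ 2 * Wcal t) N al _ mN PN _ _.
have -> : (fun n => Ex P (fun t =>
    cos (th * (((h n t)%:R - What t * a n) / Num.sqrt (n%:R `^ p)) + al))) =
  (fun n => Ex P (fun t => cos (al + l n (h n t) * (h n t)%:R - l n (h n t) * a n * What t))).
  by apply/funext => n; congr (Ex P _); apply/funext => t; congr cos; rewrite /l /s; ring.
apply.
- exact: measurable_funM.
- move=> t Nt; have cw := cWcal Nt.
  have E n : (0 < n)%N -> urn_error (l n (h n t)) n (h n t)%:R =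
      8 * (`|th| ^+ 3 * (w n t * (s n)^-1) + `|th| ^+ 4 * (w n t * (n%:R `^ p)^-1) +
           2 * `|th| ^+ 2 * (w n t * (w n t * v n + n%:R^-1))).
    move=> n0; rewrite /urn_error /l /w /v normrM normfV (gtr0_norm (s0 n n0)) -s2.
    by field; rewrite (gt_eqF (s0 n n0)) /= pnatr_eq0 -lt0n n0.
  have c : 8 * (`|th| ^+ 3 * (w n t * (s n)^-1) + `|th| ^+ 4 * (w n t * (n%:R `^ p)^-1) +
           2 * `|th| ^+ 2 * (w n t * (w n t * v n + n%:R^-1))) @[n --> \oo] -->
      8 * (`|th| ^+ 3 * (Wcal t * 0) + `|th| ^+ 4 * (Wcal t * 0) +
           2 * `|th| ^+ 2 * (Wcal t * (Wcal t * 0 + 0))).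
    apply: cvgM; first exact: cvg_cst.
    apply: cvgD; first apply: cvgD; (apply: cvgM; first exact: cvg_cst).
    - exact: cvgM.
    - by apply: cvgM => //; exact: natpow_inv_cvg0.
    - by apply: cvgM => //; apply: cvgD => //; exact: cvgM.
  have z : 8 * (`|th| ^+ 3 * (Wcal t * 0) + `|th| ^+ 4 * (Wcal t * 0) +
           2 * `|th| ^+ 2 * (Wcal t * (Wcal t * 0 + 0))) = 0 by ring.
  rewrite z in c; apply: cvg_trans c; apply: near_eq_cvg.
  by exists 1%N => // n /= n0; rewrite E.
- move=> t Nt; have cw := cWcal Nt.
  have c : th ^+ 2 * w n t @[n --> \oo] --> th ^+ 2 * Wcal t.
    by apply: cvgM => //; exact: cvg_cst.
  apply: cvg_trans c; apply: near_eq_cvg; exists 1%N => // n /= n0.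
  by rewrite /l /w -s2; field; rewrite gt_eqF ?s0.
Qed.

(** Divergence of H_n cannot be read off [What], not yet known to be positive. Since x / (x + 1) >=
    1/2 for x >= 1, the mean of 1 / H contracts by 1 - p / (2 k) at each step; as (1 - x / 2)^2 (1 +
    x) <= 1, its square times a_k stays below a_1. *)
Lemma Ex_inv_cvg0 : Ex P (fun t => (h n t)%:R^-1) @[n --> \oo] --> 0.
Proof.
pose q n := Ex P (fun t => (h n t)%:R^-1).
have bq n : bmeas (fun t => (h n t)%:R^-1 : R) by exact: (bh n (fun x => x%:R^-1)).
have q0 n : 0 <= q n by apply: Ex_ge0 => t; rewrite invr_ge0.
have hR n t : 1 <= (h n t)%:R :> R by rewrite ler1n.
have qS k : (0 < k)%N -> q k.+1 <= (1 - p / k%:R / 2) * q k.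
  move=> k0; rewrite /q -addn1 (h_markov (n := k) (k := k) 1 (fun _ y => y%:R^-1)) ?k0//=.
  rewrite -ExZ//; apply: le_Ex => [||t].
  - exact: (bh k (urnK p k (fun y => y%:R^-1))).
  - by apply: bmeasM => //; exact: bmeas_cst.
  rewrite /urnK -natr1; have := hR k t; set x := (h k t)%:R => x1.
  have k1 : 0 < k%:R :> R by rewrite ltr0n.
  rewrite -subr_ge0.
  have -> : (1 - p / k%:R / 2) / x - ((1 - p * x / k%:R) / x + p * x / k%:R / (x + 1)) =
      p / k%:R * ((x - 1) / (2 * x * (x + 1))).
    by field; do !(apply/andP; split); rewrite gt_eqF//; lra.
  apply: mulr_ge0; first by rewrite divr_ge0// ltW.
  apply: divr_ge0; first lra.
  by apply: mulr_ge0; lra.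
have qa k : (0 < k)%N -> q k ^+ 2 * a k <= a 1.
  elim: k => // -[|k] IH _.
    have q1 : q 1 <= 1.
      rewrite -(Ex_cst P 1); apply: le_Ex => // [|t]; first exact: bmeas_cst.
      by rewrite invf_le1// (lt_le_trans ltr01).
    by apply: ler_piMl; [exact/ltW/a_gt0|rewrite exprn_ile1].
  apply: le_trans (IH isT); rewrite (aS (ltn0Sn k)).
  have k1 : 1 <= k.+1%:R :> R by rewrite ler1n.
  have := qS k.+1 isT; set x := p / _ => qk.
  have x0 : 0 <= x by rewrite divr_ge0// ltW.
  have x1 : x <= 1 by rewrite ler_pdivrMr// mul1r (le_trans (ltW p1)).
  have ak := ltW (a_gt0 (ltn0Sn k)).
  rewrite mulrA mulrAC ler_wpM2r//.
  apply: (@le_trans _ _ (((1 - x / 2) * q k.+1) ^+ 2 * (1 + x))).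
    rewrite ler_wpM2r//; first by lra.
    by rewrite ler_pXn2r// nnegrE ?q0//; exact: le_trans (q0 _) qk.
  rewrite exprMn mulrAC ler_piMl ?sqr_ge0//.
  have -> : (1 - x / 2) ^+ 2 * (1 + x) = 1 - x ^+ 2 * (3 - x) / 4 by field.
  by rewrite gerBl divr_ge0// mulr_ge0 ?sqr_ge0//; lra.
apply/cvgr0Pnorm_le => e e0; rewrite -/q.
have a1 := a_gt0 (ltnSn 0).
have := a_inv_cvg0 => /cvgr0Pnorm_le/(_ (e ^+ 2 / a 1)); rewrite divr_gt0 ?exprn_gt0//.
move=> /(_ isT) ae; near=> n.
have n0 : (0 < n)%N by near: n; exists 1%N.
have qn0 : 0 <= Ex P (fun t => (h n t)%:R^-1) := q0 n.
rewrite ger0_norm// -(ler_pXn2r (n := 2))// ?nnegrE ?(ltW e0)//.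
have : `|(a n)^-1| <= e ^+ 2 / a 1 by near: n.
rewrite ger0_norm ?invr_ge0 ?(ltW (a_gt0 n0))// ler_pdivlMr// => h1.
apply: le_trans h1; rewrite [leRHS]mulrC ler_pdivlMr ?a_gt0//; exact: qa.
Unshelve. all: by end_near. Qed.

Let M0 : set T := \bigcup_j \bigcap_n [set t | (h n t <= j)%N].

Let mhle n j : measurable [set t | (h n t <= j)%N].
Proof.
have := mh n (fun x => (x <= j)%:R) measurableT (measurable_set1 (1 : R)).
rewrite setTI; congr measurable; apply/seteqP; split => t /=.
  by case: leqP => // _ /eqP; rewrite eq_sym oner_eq0.
by move=> ->.
Qed.

Let mM0 : measurable M0.
Proof. by apply: bigcupT_measurable => j; apply: bigcapT_measurable => n; exact: mhle. Qed.

(** While the count stays below [j], 1 <= j / h: Markov's inequality applied to 1 / h. *)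
Let PM0 : P M0 = 0%E.
Proof.
have A0 j : P (\bigcap_n [set t | (h n t <= j)%N]) = 0%E.
  set A := \bigcap_n _.
  have mA : measurable A by apply: bigcapT_measurable => n; exact: mhle.
  have fA : fine (P A) <= 0.
    have c : j%:R * Ex P (fun t => (h n t)%:R^-1) @[n --> \oo] --> (j%:R * 0 : R).
      by apply: cvgM; [exact: cvg_cst|exact: Ex_inv_cvg0].
    rewrite mulr0 in c; apply: (cvgr_to_ge c); apply: nearW => n.
    have bq : bmeas (fun t => (h n t)%:R^-1 : R) by exact: (bh n (fun x => x%:R^-1)).
    rewrite -Ex_indic// -ExZ//; apply: le_Ex => [||t].
    - exact: bmeas_indic.
    - by apply: bmeasM => //; exact: bmeas_cst.
    rewrite indicE; have [At|At] := boolP (t \in A); last by rewrite divr_ge0.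
    move: At; rewrite inE => /(_ n I) /= hj.
    by rewrite ler_pdivlMr ?ltr0n// mul1r ler_nat.
  have := fin_num_measure P A mA; rewrite ge0_fin_numE// => Afin.
  apply/eqP; rewrite eq_le measure_ge0 andbT.
  by rewrite -(@fineK _ (P A)) ?lee_fin// ge0_fin_numE.
apply/(negligibleP P mM0); apply: negligible_bigcup => j; apply/negligibleP; last exact: A0.
by apply: bigcapT_measurable => n; exact: mhle.
Qed.

Let h_inv_cvg0 t : ~ M0 t -> (h n t)%:R^-1 @[n --> \oo] --> (0 : R).
Proof.
move=> Mt; apply/cvgr0Pnorm_le => e e0.
have [j hj] : exists n, (Num.truncn e^-1 < h n t)%N.
  apply: contrapT => /forallNP nh; apply: Mt; exists (Num.truncn e^-1) => // n _ /=.
  by rewrite leqNgt; apply/negP.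
exists j => // n /= jn.
rewrite ger0_norm ?invr_ge0// -[leRHS]invrK lef_pV2 ?posrE ?ltr0n ?invr_gt0//.
apply: ltW; apply: lt_le_trans (real_truncnS_gt (num_real _)) _.
by rewrite ler_nat; apply: leq_trans hj _; exact: h_homo.
Qed.

(** Normalized by the present count, so that the scale is a function of [h n t] as [clt_limit]
    demands. *)
Let Yn n t : R := ((h n t)%:R - What t * a n) / Num.sqrt (h n t)%:R.

Let mYn n : measurable_fun setT (Yn n).
Proof.
apply: measurable_funM; last exact: (mh n (fun x => (Num.sqrt x%:R)^-1)).
by apply: measurable_funB; [exact: (mh n (fun x => x%:R))|exact: measurable_funM].
Qed.

Let mNM0 : measurable (N `|` M0). Proof. exact: measurableU. Qed.

Let PNM0 : P (N `|` M0) = 0%E.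
Proof. by rewrite null_set_setU. Qed.

Lemma clt_self_normalized : cvg_in_law P Yn (normal_prob 0 1) (fun x : R => x).
Proof.
apply: levy_cvg_in_law => // th al.
rewrite Ex_cos_normal.
pose l (n x : nat) := th / Num.sqrt x%:R.
pose s n t := Num.sqrt (h n t)%:R : R.
have s0 n t : 0 < s n t by rewrite sqrtr_gt0 ltr0n.
have s2 n t : s n t ^+ 2 = (h n t)%:R by rewrite sqr_sqrtr.
have := @clt_limit l (fun=> th ^+ 2) (N `|` M0) al _ mNM0 PNM0 _ _.
have -> : (fun n => Ex P (fun t => cos (th * Yn n t + al))) =
  (fun n => Ex P (fun t => cos (al + l n (h n t) * (h n t)%:R - l n (h n t) * a n * What t))).
  by apply/funext => n; congr (Ex P _); apply/funext => t; congr cos; rewrite /l /Yn; ring.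
rewrite Ex_cst; apply => //.
- move=> t Mt; have [Nt M0t] : ~ N t /\ ~ M0 t by split => ?; apply: Mt; [left|right].
  have cw := cWcal Nt; have ch := h_inv_cvg0 M0t.
  have cs : (s n t)^-1 @[n --> \oo] --> 0.
    have -> : (fun n => (s n t)^-1) = (fun n => Num.sqrt (h n t)%:R^-1).
      by apply/funext => n; rewrite sqrtrV.
    by rewrite -(@sqrtr0 R); apply: continuous_cvg => //; exact: sqrt_continuous.
  have E n : (0 < n)%N -> urn_error (l n (h n t)) n (h n t)%:R =
      8 * (`|th| ^+ 3 * (s n t)^-1 + `|th| ^+ 4 * (h n t)%:R^-1 +
           2 * `|th| ^+ 2 * (w n t * v n + n%:R^-1)).
    move=> n0; have pn := pow_gt0 n0.
    rewrite /urn_error /l /w /v normrM normfV -/(s n t) (gtr0_norm (s0 n t)) -s2.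
    by field; rewrite (gt_eqF pn) (gt_eqF (s0 n t)) /= pnatr_eq0 -lt0n n0.
  have c : 8 * (`|th| ^+ 3 * (s n t)^-1 + `|th| ^+ 4 * (h n t)%:R^-1 +
           2 * `|th| ^+ 2 * (w n t * v n + n%:R^-1)) @[n --> \oo] -->
      8 * (`|th| ^+ 3 * 0 + `|th| ^+ 4 * 0 + 2 * `|th| ^+ 2 * (Wcal t * 0 + 0)).
    apply: cvgM; first exact: cvg_cst.
    apply: cvgD; first apply: cvgD; (apply: cvgM; first exact: cvg_cst) => //.
    by apply: cvgD => //; exact: cvgM.
  have z : 8 * (`|th| ^+ 3 * 0 + `|th| ^+ 4 * 0 + 2 * `|th| ^+ 2 * (Wcal t * 0 + 0)) = 0.
    by ring.
  rewrite z in c; apply: cvg_trans c; apply: near_eq_cvg.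
  by exists 1%N => // n /= n0; rewrite E.
- move=> t _; have -> : (fun n => l n (h n t) ^+ 2 * (h n t)%:R) = (fun=> th ^+ 2).
    apply/funext => n; rewrite /l -/(s n t) -s2; field.
    by rewrite gt_eqF ?s0.
  exact: cvg_cst.
Qed.

Lemma cvg_in_law_Ex {d'} {S : measurableType d'} (Q : probability S R)
    (Y : nat -> T -> R) (V : S -> R) (f : R -> R) (M : R) :
  cvg_in_law P Y Q V -> (forall n, measurable_fun setT (Y n)) ->
  measurable_fun setT V -> continuous f -> (forall x, `|f x| <= M) ->
  Ex P (fun t => f (Y n t)) @[n --> \oo] --> Ex Q (fun s => f (V s)).
Proof.
move=> YV mY mV cf fM; have mf := continuous_measurable_fun cf.
have bf (d0 : measure_display) (A : measurableType d0) (W : A -> R) : measurable_fun setT W ->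
    bmeas (fun t => f (W t)).
  by move=> mW; split; [exact: measurableT_comp|exists M].
have := YV f cf (ex_intro _ M fM); rewrite ExE; last exact: bf.
have e n : (\int[P]_t (f (Y n t))%:E)%E = (Ex P (fun t => f (Y n t)))%:E.
  by rewrite ExE//; exact: bf.
rewrite (funext e) => /fine_cvg; exact.
Qed.

Let gker_cvg l : Ex P (fun t => gker l (Yn n t)) @[n --> \oo] -->
  Ex (normal_prob 0 1) (gker l).
Proof.
apply: (cvg_in_law_Ex (M := 1) clt_self_normalized) => //.
  exact: continuous_gker.
by move=> x; rewrite ger0_norm ?gker_le1 ?gker_ge0.
Qed.

Let M1 : set T := [set t | What t <= 0].

Let mM1 : measurable M1.
Proof. by rewrite -[M1]setTI; exact: measurable_fun_le. Qed.

(** The cut-off [gker l] splits the probability of [M1]. The part it keeps tends to 0, since [Yn]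
    escapes to infinity there; the part it removes is at most 1 - Ex P (gker l Yn), whose limit is
    below any prescribed [e]. *)
Let PM1 : P M1 = 0%E.
Proof.
suff fA : fine (P M1) <= 0.
  have := fin_num_measure P _ mM1; rewrite ge0_fin_numE// => Afin.
  apply/eqP; rewrite eq_le measure_ge0 andbT.
  by rewrite -(@fineK _ (P M1)) ?lee_fin// ge0_fin_numE.
apply/ler_addgt0Pr => e e0; rewrite add0r.
have [l l0 hl] := @gker_tight R _ _ (normal_prob 0 1) id e (@measurable_id _ _ _) e0.
rewrite -Ex_indic//.
have bk n : bmeas (fun t => gker l (Yn n t)).
  split; first by apply: (measurableT_comp (measurable_gker l)).
  by exists 1 => t; rewrite ger0_norm ?gker_le1 ?gker_ge0.
have b1 : bmeas (\1_M1 : T -> R) by exact: bmeas_indic.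
have c0 : Ex P (fun t => \1_M1 t * gker l (Yn n t)) @[n --> \oo] --> Ex P (fun=> 0).
  apply: (@Ex_cvg _ _ _ P _ _ 1 (N `|` M0)) => //.
  - by move=> n; have [] := bmeasM b1 (bk n).
  - move=> n t; rewrite normrM mulr_ile1//; last first.
      by rewrite ger0_norm ?gker_le1 ?gker_ge0.
    by rewrite indicE; case: (_ \in _); rewrite ?normr1 ?normr0.
  move=> t Mt; have [Nt M0t] : ~ N t /\ ~ M0 t by split => ?; apply: Mt; [left|right].
  rewrite indicE; have [At|At] := boolP (t \in M1); last first.
    by under eq_fun do rewrite mul0r; exact: cvg_cst.
  under eq_fun do rewrite mul1r.
  have W0 : What t = 0.
    apply/eqP; rewrite eq_le; apply/andP; split; first by move: At; rewrite inE.
    apply: (cvgr_to_ge (cWhat Nt)); exists 1%N => // n /= n0.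
    by rewrite divr_ge0// ltW// a_gt0.
  (* Since [What t] is 0, [Yn n t] is sqrt(H_n) and its kernel is exp(- l^2 H_n / 2), bounded by 2 /
     (l^2 H_n) through exp(- y) <= 1 / y. *)
  have c : 2 / l ^+ 2 * (h n t)%:R^-1 @[n --> \oo] --> 0.
    by rewrite -(mulr0 (2 / l ^+ 2)); apply: cvgM; [exact: cvg_cst|exact: h_inv_cvg0].
  apply: (squeeze_cvgr _ (cvg_cst 0) c); apply: nearW => n.
  rewrite gker_ge0/= /gker /Yn W0 mul0r subr0.
  set x := (h n t)%:R; have x0 : 0 < x :> R by rewrite ltr0n.
  have -> : (l * (x / Num.sqrt x)) ^+ 2 / 2 = l ^+ 2 * x / 2.
    rewrite exprMn expr_div_n sqr_sqrtr ?(ltW x0)//; field.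
    by rewrite gt_eqF.
  have y0 : 0 < l ^+ 2 * x / 2 by rewrite divr_gt0// mulr_gt0// exprn_gt0.
  have -> : 2 / l ^+ 2 / x = (l ^+ 2 * x / 2)^-1.
    by field; rewrite !gt_eqF.
  rewrite expRN lef_pV2 ?posrE ?expR_gt0//.
  by have := expR_ge1Dx (l ^+ 2 * x / 2); lra.
have up n : Ex P \1_M1 <= Ex P (fun t => \1_M1 t * gker l (Yn n t)) +
    (1 - Ex P (fun t => gker l (Yn n t))).
  have E : Ex P (fun t => \1_M1 t * gker l (Yn n t)) +
    (1 - Ex P (fun t => gker l (Yn n t))) =
    Ex P (fun t => \1_M1 t * gker l (Yn n t) + (1 - gker l (Yn n t))).
    rewrite ExD ?ExB ?Ex_cst//; [exact: bmeas_cst|exact: bmeasM|].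
    by apply: bmeasB => //; exact: bmeas_cst.
  rewrite E; apply: le_Ex => // [|t].
    by apply: bmeasD; [exact: bmeasM|apply: bmeasB => //; exact: bmeas_cst].
  have k1 := gker_le1 l (Yn n t).
  by rewrite indicE; case: (_ \in _); rewrite ?mulr1n ?mulr0n ?mul1r ?mul0r; lra.
apply: le_trans hl; rewrite Ex_cst in c0.
have c2 : Ex P (fun t => \1_M1 t * gker l (Yn n t)) +
    (1 - Ex P (fun t => gker l (Yn n t))) @[n --> \oo] -->
    (0 + (1 - Ex (normal_prob 0 1) (gker l)) : R).
  by apply: cvgD => //; apply: cvgB; [exact: cvg_cst|exact: gker_cvg].
rewrite add0r in c2.
by apply: (cvgr_to_ge c2); apply: nearW => n; exact: up.
Qed.

Lemma What_gt0 : exists M : set T, [/\ measurable M, P M = 0%E &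
  forall t, ~ M t -> 0 < What t].
Proof. by exists M1; split=> // t /negP; rewrite -ltNge. Qed.

Let norm_cosB_le (x y : R) : `|cos x - cos y| <= `|x - y|.
Proof.
have [c _ e] : exists2 c, `|c| <= `|x - y| &
    cos (x - y + y) - cos y = - sin (c + y) * (x - y).
  apply: (@mvt_at0 R (fun u => cos (u + y) - cos y) (fun u => - sin (u + y))) => [u|].
    have da : is_derive u 1 (fun u : R => u + y) 1.
      by apply: is_derive_eq; rewrite addr0.
    have dc : is_derive u 1 (fun u => cos (u + y)) (- sin (u + y) * 1).
      exact: (@is_derive1_comp R cos (fun u : R => u + y) u).
    by apply: is_derive_eq; rewrite mulr1 subr0.
  by rewrite add0r subrr.
rewrite -{1}(subrK y x) e normrM normrN ler_piMl//; exact: sin_max.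
Qed.

(* [powR] rather than the inverse of a square root, for measurability: the two
   agree wherever [What t] is positive. *)
Definition normalized_error n t : R :=
  ((h n t)%:R - What t * a n) * (What t * a n) `^ (- 2^-1).

Lemma measurable_normalized_error n : measurable_fun setT (normalized_error n).
Proof.
apply: measurable_funM.
  by apply: measurable_funB; [exact: (mh n (fun x => x%:R))|exact: measurable_funM].
by apply: (measurableT_comp (measurable_powR _)); exact: measurable_funM.
Qed.

(** Slutsky's argument: the two normalizations differ by the factor [rho], which tends to 1 almost
    surely because [What] is positive. For [|Yn| < 2 / l] the phases differ by at most
    [|th| * (2 / l) * |rho - 1|]; elsewhere [gker l <= 1 / 2] charges the trivial bound 2 to the
    cut-off. *)
Lemma clt_normalized :
  cvg_in_law P normalized_error (normal_prob 0 1) (fun x : R => x).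
Proof.
apply: levy_cvg_in_law => // [n|th al]; first exact: measurable_normalized_error.
pose f x := cos (th * x + al).
have cf : continuous f.
  move=> x; apply: (cvg_comp (fun x => th * x + al) (@cos R)); last exact: continuous_cos.
  by apply: cvgD; [apply: cvgM; [exact: cvg_cst|exact: cvg_id]|exact: cvg_cst].
have fM x : `|f x| <= 1 by exact: cos_max.
have mf := continuous_measurable_fun cf.
have cB := cvg_in_law_Ex clt_self_normalized mYn (@measurable_id _ _ _) cf fM.
have bY n : bmeas (fun t => f (Yn n t)).
  by split; [exact: measurableT_comp|exists 1].
have bZ n : bmeas (fun t => f (normalized_error n t)).
  by split; [apply: measurableT_comp => //; exact: measurable_normalized_error|exists 1].
have bk l n : bmeas (fun t => gker l (Yn n t)).
  split; first by apply: (measurableT_comp (measurable_gker l)).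
  by exists 1 => t; rewrite ger0_norm ?gker_le1 ?gker_ge0.
pose rho n t : R := Num.sqrt (h n t)%:R * (What t * a n) `^ (- 2^-1).
have mrho n : measurable_fun setT (rho n).
  apply: measurable_funM; first exact: (mh n (fun x => Num.sqrt x%:R)).
  by apply: (measurableT_comp (measurable_powR _)); exact: measurable_funM.
have Zrho n t : normalized_error n t = Yn n t * rho n t.
  rewrite /normalized_error /Yn /rho; field.
  by rewrite gt_eqF// sqrtr_gt0 ltr0n.
pose g c n t := Num.min 2 (c * `|rho n t - 1|).
have bg c n : 0 <= c -> bmeas (g c n).
  move=> c0; apply: bmeas_minr => // [t|]; first exact: mulr_ge0.
  apply: measurable_funM => //; apply: measurableT_comp => //.
  exact: measurable_funB.
pose M := N `|` M0 `|` M1.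
have mM : measurable M by exact: measurableU.
have PM : P M = 0%E by rewrite null_set_setU.
have cg c : 0 <= c -> Ex P (g c n) @[n --> \oo] --> 0.
  move=> c0; rewrite -(Ex_cst P 0); apply: (@Ex_cvg _ _ _ P _ _ 2 M) => //.
  - by move=> n; case: (bg c n c0).
  - move=> n t; have r0 : 0 <= c * `|rho n t - 1| by exact: mulr_ge0.
    by rewrite /g ger0_norm ?ge_min ?lexx// le_min r0 andbT.
  move=> t Mt; have Nt : ~ N t by move=> ?; apply: Mt; left; left.
  have W0 : 0 < What t.
    by rewrite ltNge; apply/negP => W0; apply: Mt; right.
  have cr : rho n t @[n --> \oo] --> (1 : R).
    have c1 : Num.sqrt ((h n t)%:R / a n / What t) @[n --> \oo] --> Num.sqrt (What t / What t).
      apply: continuous_cvg; first exact: sqrt_continuous.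
      by apply: cvgM; [exact: cWhat|exact: cvg_cst].
    rewrite divff ?gt_eqF// sqrtr1 in c1.
    apply: cvg_trans c1; apply: near_eq_cvg; exists 1%N => // n /= n0.
    have an := a_gt0 n0.
    rewrite /rho powRN powR12_sqrt; last by rewrite mulr_ge0// ltW.
    by rewrite -mulrA -invfM [a n * _]mulrC sqrtrM// sqrtrV// mulr_ge0// ltW.
  have c2 : c * `|rho n t - 1| @[n --> \oo] --> 0.
    rewrite -(mulr0 c); apply: cvgM; first exact: cvg_cst.
    rewrite -(@normr0 _ R) -(subrr 1); apply: cvg_norm; apply: cvgB => //; exact: cvg_cst.
  apply: (squeeze_cvgr _ (cvg_cst 0) c2); apply: nearW => n.
  have r0 : 0 <= c * `|rho n t - 1| by exact: mulr_ge0.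
  by rewrite /g le_min r0 ge_min lexx orbT !andbT.
have pt l n t : 0 < l -> `|f (normalized_error n t) - f (Yn n t)| <=
    g (`|th| * (2 / l)) n t + 4 * (1 - gker l (Yn n t)).
  move=> l0; have k1 := gker_le1 l (Yn n t).
  have d2 : `|f (normalized_error n t) - f (Yn n t)| <= 2.
    apply: le_trans (ler_normB _ _) _.
    by have := fM (normalized_error n t); have := fM (Yn n t); lra.
  have [Yl|Yl] := leP (2 / l) `|Yn n t|.
    have g0 : 0 <= g (`|th| * (2 / l)) n t.
      by rewrite /g le_min; apply/andP; split => //; rewrite !mulr_ge0// invr_ge0 ltW.
    by have := gker_le_half l0 Yl; lra.
  rewrite -[leLHS]addr0 lerD//; last by rewrite mulr_ge0// subr_ge0.
  rewrite /g le_min d2 /=; apply: le_trans (norm_cosB_le _ _) _.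
  rewrite Zrho (_ : _ - _ = th * (Yn n t * (rho n t - 1))); last by ring.
  by rewrite normrM normrM -mulrA ler_wpM2l// ler_wpM2r// ltW.
apply/cvgrPdist_le => e e0.
have [l l0 hl] := @gker_tight R _ _ (normal_prob 0 1) id (e / 12)
  (@measurable_id _ _ _) (divr_gt0 e0 (ltr0Sn _ _)).
have e12 : 0 < e / 12 by exact: divr_gt0.
have c0 : 0 <= `|th| * (2 / l) by rewrite !mulr_ge0// invr_ge0 ltW.
have e4 : 0 < e / 4 by exact: divr_gt0.
have := cg _ c0 => /cvgr0Pnorm_le/(_ _ e4) n1.
have := @gker_cvg l => /cvgrPdist_le/(_ _ e12) n2.
move/cvgrPdist_le: cB => /(_ _ e12) n3.
(* The budget is e / 4 + 4 (e / 12 + e / 12) + e / 12 = e. *)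
have arith (x1 x2 x3 x4 x5 x6 : R) : `|x1| <= e / 4 -> `|x2 - x3| <= e / 12 ->
    `|x4 - x5| <= e / 12 -> `|x6 - x5| <= x1 + 4 * (1 - x3) -> 1 - x2 <= e / 12 ->
    `|x4 - x6| <= e.
  rewrite !ler_norml.
  by move=> /andP[_ ?] /andP[? ?] /andP[? ?] /andP[? ?] ?; apply/andP; split; lra.
near=> n.
have m1 : `|Ex P (g (`|th| * (2 / l)) n)| <= e / 4 by near: n.
have m2 : `|Ex (normal_prob 0 1) (gker l) - Ex P (fun t => gker l (Yn n t))| <= e / 12.
  by near: n.
have m3 : `|Ex (normal_prob 0 1) (fun x => f x) - Ex P (fun t => f (Yn n t))| <= e / 12.
  by near: n.
have bgn := bg (`|th| * (2 / l)) n c0.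
have b1k : bmeas (fun t => 4 * (1 - gker l (Yn n t))).
  apply: bmeasM; first exact: bmeas_cst.
  by apply: bmeasB => //; exact: bmeas_cst.
have m4 : `|Ex P (fun t => f (normalized_error n t)) - Ex P (fun t => f (Yn n t))| <=
    Ex P (g (`|th| * (2 / l)) n) + 4 * (1 - Ex P (fun t => gker l (Yn n t))).
  have -> : Ex P (g (`|th| * (2 / l)) n) + 4 * (1 - Ex P (fun t => gker l (Yn n t))) =
    Ex P (fun t => g (`|th| * (2 / l)) n t + 4 * (1 - gker l (Yn n t))).
    rewrite ExD// ExZ ?ExB ?Ex_cst//; first exact: bmeas_cst.
    by apply: bmeasB => //; exact: bmeas_cst.
  rewrite -ExB//; apply: le_trans (Ex_norm P (bmeasB (bZ n) (bY n))) _.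
  apply: le_Ex => [||t]; last exact: pt.
    exact/bmeas_norm/bmeasB.
  exact: bmeasD.
exact: (arith _ _ _ _ _ _ m1 m2 m3 m4 hl).
Unshelve. all: by end_near. Qed.

(** Averaging first over the normal variable turns the characteristic function of the mixture into
    the mean of exp(- th^2 Wcal / 2) cos al, the limit in [clt_stable]. *)
Lemma clt_mixed {d'} {S : measurableType d'} (Q : probability S R) (W' Z : S -> R) :
  measurable_fun setT W' -> measurable_fun setT Z -> indep2 Q W' Z ->
  (forall A : set R, measurable A -> Q (W' @^-1` A) = P (Wcal @^-1` A)) ->
  (forall A : set R, measurable A -> Q (Z @^-1` A) = normal_prob 0 1 A) ->
  cvg_in_law P (fun n t => ((h n t)%:R - What t * a n) / Num.sqrt (n%:R `^ p))
    Q (fun s => Num.sqrt (W' s) * Z s).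
Proof.
move=> mW mZ WZ lW lZ.
have msqrt : measurable_fun setT (@Num.sqrt R).
  by apply: continuous_measurable_fun; exact: sqrt_continuous.
apply: levy_cvg_in_law.
- move=> n; apply: measurable_funM => //.
  by apply: measurable_funB; [exact: (mh n (fun x => x%:R))|exact: measurable_funM].
- by apply: measurable_funM => //; exact: measurableT_comp.
move=> th al.
pose F (wz : R * R) := cos (th * (Num.sqrt wz.1 * wz.2) + al).
have bF : bmeas F.
  split; last by exists 1 => x; exact: cos_max.
  apply: measurableT_comp => //; apply: measurable_funD => //.
  apply: measurable_funM => //; apply: measurable_funM; last exact: measurable_snd.
  by apply: (measurableT_comp msqrt); exact: measurable_fst.
have := @Ex_indep_law R _ _ _ _ _ _ _ _ P Q (normal_prob 0 1) W' Z Wcal F mW mZ mWcal WZ lW lZ bF.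
rewrite /F /= => ->.
have -> : Ex P (fun t => Ex (normal_prob 0 1)
      (fun z => cos (th * (Num.sqrt (Wcal t) * z) + al))) =
    Ex P (fun t => expR (- (th ^+ 2 * Wcal t / 2)) * cos al).
  have E t : Ex (normal_prob 0 1) (fun z => cos (th * (Num.sqrt (Wcal t) * z) + al)) =
      expR (- ((th * Num.sqrt (Wcal t)) ^+ 2 / 2)) * cos al.
    by rewrite -Ex_cos_normal; congr Ex; apply/funext => z; rewrite mulrA.
  rewrite (funext E).
  (* [Wcal] is known to be nonnegative only off [N], and the square root of a negative number is 0,
     so the integrands may differ on [N]. *)
  rewrite /Ex /Rintegral; congr fine; apply: (integral_null_eq mN PN) => t Nt.
  have W0 : 0 <= Wcal t.
    apply: (cvgr_to_ge (cWcal Nt)); apply: nearW => n.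
    by rewrite divr_ge0// powR_ge0.
  by rewrite exprMn sqr_sqrtr.
exact: clt_stable.
Qed.

End urn_limit.

Theorem theorem2p3 (R : realType) (p : R)
  (d : measure_display) (T : measurableType d) (P : probability T R)
  (U : nat -> T -> nat) (B : nat -> T -> bool) (X : nat -> T -> R)
  (What Wcal : T -> R) :
  0 < p < 1 ->
  (* U_n uniform on {1,...,n}, B_n Bernoulli(p), all mutually independent *)
  (forall n k, measurable [set t | U n t = k]) ->
  (forall n b, measurable [set t | B n t = b]) ->
  (forall n k, (1 <= k <= n)%N -> P [set t | U n t = k] = (n%:R^-1)%:E) ->
  (forall n, (0 < n)%N -> P [set t | B n t = true] = p%:E) ->
  indep_UB P U B ->
  (* X_1 = 1, X_{n+1} = X_{U_n} if B_n, else 0 *)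
  (forall t, X 1%N t = 1) ->
  (forall n t, (0 < n)%N -> X n.+1 t = if B n t then X (U n t) t else 0) ->
  (* What = lim H_n / a_n a.s., Wcal = lim H_n / n^p a.s.,
     where H_n = sum_{i=1}^n X_i *)
  measurable_fun setT What ->
  {ae P, forall t, (fun n => (\sum_(1 <= i < n.+1) X i t) / a_seq p n)
                     @ \oo --> What t} ->
  measurable_fun setT Wcal ->
  {ae P, forall t, (fun n => (\sum_(1 <= i < n.+1) X i t) / (n%:R `^ p))
                     @ \oo --> Wcal t} ->
  cvg_in_law P
    (fun n t => ((\sum_(1 <= i < n.+1) X i t) - What t * a_seq p n)
                / Num.sqrt (What t * a_seq p n))
    (normal_prob 0 1) (fun x : R => x)
  /\
  (forall (d' : measure_display) (S : measurableType d') (Q : probability S R)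
     (W' Z : S -> R),
     measurable_fun setT W' -> measurable_fun setT Z ->
     indep2 Q W' Z ->
     (forall A : set R, measurable A -> Q (W' @^-1` A) = P (Wcal @^-1` A)) ->
     (forall A : set R, measurable A -> Q (Z @^-1` A) = normal_prob 0 1 A) ->
     cvg_in_law P
       (fun n t => ((\sum_(1 <= i < n.+1) X i t) - What t * a_seq p n)
                   / Num.sqrt (n%:R `^ p))
       Q (fun s => Num.sqrt (W' s) * Z s)).
Proof.
move=> p01 mU mB PU PB iUB X1 XS mWhat aeWhat mWcal aeWcal.
pose h n t := ones (urn_hist U B n.-1 t).
have [N1 [mN1 PN1 N1sub]] := aeWhat.
have [N2 [mN2 PN2 N2sub]] := aeWcal.
(* Where some draw is out of range, [X] and [urn_hist] may disagree. *)
pose N3 := \bigcup_n [set t | ~ (1 <= U n.+1 t <= n.+1)%N].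
have mN3 : measurable N3 by apply: bigcupT_measurable => n; exact: (measurable_draw_range mU).
have PN3 : P N3 = 0%E.
  apply/(negligibleP P mN3); apply: negligible_bigcup => n.
  by apply/negligibleP; [exact: (measurable_draw_range mU)|exact: (draw_null mU PU)].
pose N := N1 `|` N2 `|` N3.
have mN : measurable N by apply: measurableU => //; exact: measurableU.
have PN : P N = 0%E by rewrite !null_set_setU//; exact: measurableU.
have sumE t n : ~ N t -> (0 < n)%N -> \sum_(1 <= i < n.+1) X i t = (h n t)%:R.
  case: n => // n Nt _; apply: sum_urn_hist => // [m|[//|m] _]; first exact: XS.
  by apply: contrapT => nU; apply: Nt; right; exists m.
have h_gt0 n t : (0 < h n t)%N by exact: ones_urn_hist_gt0.
have h_le n t : (0 < n)%N -> (h n t <= n)%N.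
  by case: n => // n _; exact: ones_urn_hist_le.
have h_homo t : {homo h^~ t : m n / (m <= n)%N}.
  by move=> m n mn; apply: ones_urn_hist_homo; rewrite -!subn1 leq_sub2r.
have bh n (g : nat -> R) : bmeas (fun t => g (h n t)).
  exact: (bmeas_urn_hist mU mB n.-1 (fun s => g (ones s))).
have h_markov n k m (f : nat -> nat -> R) : (0 < n <= k)%N ->
    Ex P (fun t => f (h n t) (h (k + m)%N t)) =
    Ex P (fun t => urnKs p k m (f (h n t)) (h k t)).
  exact: Ex_urn_steps.
have a_gt0 k : (0 < k)%N -> 0 < a_seq p k by exact: a_seq_gt0.
have aS k : (0 < k)%N -> a_seq p k.+1 = a_seq p k * (1 + p / k%:R) by exact: a_seqS.
have cWhat t : ~ N t -> (h n t)%:R / a_seq p n @[n --> \oo] --> What t.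
  move=> Nt.
  have c : (\sum_(1 <= i < n.+1) X i t) / a_seq p n @[n --> \oo] --> What t.
    by apply: contrapT => nc; apply: Nt; left; left; exact: N1sub.
  apply: cvg_trans c; apply: near_eq_cvg; exists 1%N => // n /= n0.
  by rewrite sumE.
have cWcal t : ~ N t -> (h n t)%:R / n%:R `^ p @[n --> \oo] --> Wcal t.
  move=> Nt.
  have c : (\sum_(1 <= i < n.+1) X i t) / n%:R `^ p @[n --> \oo] --> Wcal t.
    by apply: contrapT => nc; apply: Nt; left; right; exact: N2sub.
  apply: cvg_trans c; apply: near_eq_cvg; exists 1%N => // n /= n0.
  by rewrite sumE.
split.
  move=> f cf bf.
  have := clt_normalized p01 a_gt0 aS h_gt0 h_le h_homo bh h_markov mWhat mN PN
    cWhat cWcal cf bf.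
  apply: cvg_trans; apply: near_eq_cvg; exists 1%N => // n /= n0.
  have [M [mM PM Wpos]] := What_gt0 p01 a_gt0 aS h_gt0 h_le h_homo bh h_markov
    mWhat mN PN cWhat cWcal.
  (* Off [N] and [M] the sum equals [h n t] and [What t * a_seq p n] is positive, so division by its
     square root agrees with the power - 1/2 in [normalized_error]. *)
  apply: (@integral_null_eq _ _ _ P (N `|` M)); first exact: measurableU.
    by rewrite null_set_setU.
  move=> t NMt; have Nt : ~ N t by move=> ?; apply: NMt; left.
  have W0 : 0 < What t by apply: Wpos => ?; apply: NMt; right.
  rewrite sumE// /normalized_error powRN powR12_sqrt//.
  by rewrite mulr_ge0// ltW// a_gt0.
move=> d' S Q W' Z mW' mZ WZ lW lZ f cf bf.
have := clt_mixed p01 a_gt0 aS h_le bh h_markov mWhat mWcal mN PN cWhat cWcal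
  mW' mZ WZ lW lZ cf bf.
apply: cvg_trans; apply: near_eq_cvg; exists 1%N => // n /= n0.
by apply: (integral_null_eq mN PN) => t Nt; rewrite sumE.
Qed.
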